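(* Let $T>0$ be fixed, $h_n=T/n$ and $\alpha\in(0,1)$. Assume that each of the drifts $B_1,\dots,B_4$ is globally Lipschitz and of class $C^4$ with all partial derivatives of order $0$ to $4$ of polynomial growth, and that $\sup_t\mathbb{E}[|Y_t|^{\ell}]<\infty$ for all $\ell\ge 0$ and each $Y\in\{\xi_0,\delta_0,\varepsilon_0,\zeta_0\}$. Assume $H_1$: $\mathbf{\Sigma}_0\ne\mathbf{\Sigma}(\theta)$ for every $\theta\in\Theta$. Suppose that $\mathbb{U}(\theta)=\mathrm{F}(\mathbf{\Sigma}_0,\mathbf{\Sigma}(\theta))$ has a unique minimizer $\bar\theta$ on $\Theta$, that the Hessian $\partial_\theta^2\mathbb{U}(\bar\theta)$ is non-singular, and that $0<\delta<\min_{j\in\bar{\mathcal{F}}_1}|\bar\theta^{(j)}|$, where $\bar{\mathcal{F}}_1=\{j:\bar\theta^{(j)}\ne0\}$. Then, as $h_n\to0$ (that is, $n\to\infty$), $\sqrt n\lambda_{1,n}\to0$ and $\sqrt n\lambda_{2,n}\to\infty$, with $\check{\mathbb{T}}_n=n\mathbb{F}_n(\check\theta_n)$, $$\mathbb{P}\Bigl(\check{\mathbb{T}}_n>\chi^2_{\bar p-|\tilde{\mathcal{F}}_{\mathbb{I},n,1}|}(\alpha)\Bigr)\to1.$$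
   Context: Notation: $\operatorname{vech}$ is half-vectorization; $v^{(j)}$ is the $j$-th coordinate of $v$; $|S|$ is the cardinality of a set $S$; $\chi^2_r(\alpha)$ is the upper $\alpha$ point of the chi-squared distribution with $r$ degrees of freedom (degrees of freedom are understood to be positive). True model and data: $p_1,p_2,k_1,k_2,r_1,\dots,r_4\ge 1$ are fixed integers with $k_1\le p_1$, $k_2\le p_2$; $p=p_1+p_2$, $\bar p=p(p+1)/2$. $W_1,\dots,W_4$ are independent standard Wiener processes of dimensions $r_1,\dots,r_4$. The latent processes $\xi_0,\delta_0,\varepsilon_0,\zeta_0$, with values in $\mathbb{R}^{k_1},\mathbb{R}^{p_1},\mathbb{R}^{p_2},\mathbb{R}^{k_2}$, solve $d\xi_{0,t}=B_1(\xi_{0,t})dt+\mathbf{S}_{1,0}dW_{1,t}$, $d\delta_{0,t}=B_2(\delta_{0,t})dt+\mathbf{S}_{2,0}dW_{2,t}$, $d\varepsilon_{0,t}=B_3(\varepsilon_{0,t})dt+\mathbf{S}_{3,0}dW_{3,t}$, $d\zeta_{0,t}=B_4(\zeta_{0,t})dt+\mathbf{S}_{4,0}dW_{4,t}$ on $[0,T]$, with deterministic initial values $c_1,\dots,c_4$ and constant matrices $\mathbf{S}_{i,0}$. Put $\mathbf{\Sigma}_{\xi\xi,0}=\mathbf{S}_{1,0}\mathbf{S}_{1,0}^\top$, $\mathbf{\Sigma}_{\delta\delta,0}=\mathbf{S}_{2,0}\mathbf{S}_{2,0}^\top$, $\mathbf{\Sigma}_{\varepsilon\varepsilon,0}=\mathbf{S}_{3,0}\mathbf{S}_{3,0}^\top$,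 $\mathbf{\Sigma}_{\zeta\zeta,0}=\mathbf{S}_{4,0}\mathbf{S}_{4,0}^\top$; $\mathbf{\Sigma}_{\delta\delta,0}$ and $\mathbf{\Sigma}_{\varepsilon\varepsilon,0}$ are positive definite. Constant matrices: $\mathbf{\Lambda}_{x_1,0}\in\mathbb{R}^{p_1\times k_1}$ of full column rank, $\mathbf{\Lambda}_{x_2,0}\in\mathbb{R}^{p_2\times k_2}$, $\mathbf{\Gamma}_0\in\mathbb{R}^{k_2\times k_1}$, $\mathbf{B}_0\in\mathbb{R}^{k_2\times k_2}$ with zero diagonal, $\mathbf{\Psi}_0=\mathbb{I}_{k_2}-\mathbf{B}_0$ non-singular. The observed process is $\mathbb{X}_t=(\mathbb{X}_{1,t}^\top,\mathbb{X}_{2,t}^\top)^\top$ with $\mathbb{X}_{1,t}=\mathbf{\Lambda}_{x_1,0}\xi_{0,t}+\delta_{0,t}$, $\mathbb{X}_{2,t}=\mathbf{\Lambda}_{x_2,0}\eta_{0,t}+\varepsilon_{0,t}$, $\eta_{0,t}=\mathbf{B}_0\eta_{0,t}+\mathbf{\Gamma}_0\xi_{0,t}+\zeta_{0,t}$. With $t_i^n=ih_n$, $T=nh_n$, $\mathbb{Q}_{\mathbb{XX}}=\frac1T\sum_{i=1}^n(\mathbb{X}_{t_i^n}-\mathbb{X}_{t_{i-1}^n})(\mathbb{X}_{t_i^n}-\mathbb{X}_{t_{i-1}^n})^\top$. Parametric model: $\Theta\subset\mathbb{R}^q$ is convex and compact. For $\theta\in\Theta$ there are matrices $\mathbf{\Lambda}_{x_1},\mathbf{\Lambda}_{x_2},\mathbf{\Gamma},\mathbf{\Psi}=\mathbb{I}_{k_2}-\mathbf{B}$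 ($\mathbf{B}$ with zero diagonal), $\mathbf{\Sigma}_{\xi\xi},\mathbf{\Sigma}_{\delta\delta},\mathbf{\Sigma}_{\varepsilon\varepsilon},\mathbf{\Sigma}_{\zeta\zeta}$ of respective sizes $p_1\times k_1$, $p_2\times k_2$, $k_2\times k_1$, $k_2\times k_2$, $k_1\times k_1$, $p_1\times p_1$, $p_2\times p_2$, $k_2\times k_2$, each entry being either a known constant or a coordinate of $\theta$ ($\theta$ collects the unknown, non-duplicated entries); $\mathbf{\Lambda}_{x_1}$ has full column rank, $\mathbf{\Psi}$ is non-singular, $\mathbf{\Sigma}_{\xi\xi},\mathbf{\Sigma}_{\zeta\zeta}$ are positive semidefinite, $\mathbf{\Sigma}_{\delta\delta},\mathbf{\Sigma}_{\varepsilon\varepsilon}$ positive definite. $\mathbf{\Sigma}(\theta)$ is the symmetric $p\times p$ matrix with blocks $\mathbf{\Sigma}^{11}=\mathbf{\Lambda}_{x_1}\mathbf{\Sigma}_{\xi\xi}\mathbf{\Lambda}_{x_1}^\top+\mathbf{\Sigma}_{\delta\delta}$, $\mathbf{\Sigma}^{12}=\mathbf{\Lambda}_{x_1}\mathbf{\Sigma}_{\xi\xi}\mathbf{\Gamma}^\top\mathbf{\Psi}^{-1\top}\mathbf{\Lambda}_{x_2}^\top$, $\mathbf{\Sigma}^{22}=\mathbf{\Lambda}_{x_2}\mathbf{\Psi}^{-1}(\mathbf{\Gamma}\mathbf{\Sigma}_{\xi\xi}\mathbf{\Gamma}^\top+\mathbf{\Sigma}_{\zeta\zeta})\mathbf{\Psi}^{-1\top}\mathbf{\Lambda}_{x_2}^\top+\mathbf{\Sigma}_{\varepsilon\varepsilon}$;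 $\mathbf{\Sigma}_0$ is the same expression evaluated at the true matrices (subscript $0$). Contrast and estimator: $\mathrm{F}(Q,\mathbf{\Sigma})=\log\det\mathbf{\Sigma}-\log\det Q+\operatorname{tr}(\mathbf{\Sigma}^{-1}Q)-p$ for $Q,\mathbf{\Sigma}$ positive definite. $\mathbb{F}_n(\theta)=\mathrm{F}(\mathbb{Q}_{\mathbb{XX}},\mathbf{\Sigma}(\theta))$ if $\mathbb{Q}_{\mathbb{XX}}$ is non-singular and $\mathbb{F}_n(\theta)=|\operatorname{vech}\mathbb{Q}_{\mathbb{XX}}-\operatorname{vech}\mathbf{\Sigma}(\theta)|^2$ otherwise. $\hat\theta_n\in\Theta$ satisfies $\mathbb{F}_n(\hat\theta_n)=\inf_{\theta\in\Theta}\mathbb{F}_n(\theta)$. Sparse estimation: $\lambda_{1,n},\lambda_{2,n},\gamma,\delta>0$ are deterministic tuning constants (the scalar $\delta$ is unrelated to the process $\delta_0$). $\kappa_n^{(j)}=\lambda_{1,n}|\hat\theta_n^{(j)}|^{-\gamma}1_{\{|\hat\theta_n^{(j)}|\ge\delta\}}+\lambda_{2,n}1_{\{|\hat\theta_n^{(j)}|<\delta\}}$, $j=1,\dots,q$. $\tilde\theta_{\mathbb{I},n}\in\Theta$ minimizes $\mathbb{Q}_{\mathbb{I},n}(\theta)=\sum_{j=1}^q(\theta^{(j)}-\hat\theta_n^{(j)})^2+\sum_{j=1}^q\kappa_n^{(j)}|\theta^{(j)}|$ over $\Theta$; $\tilde{\mathcal{F}}_{\mathbb{I},n,1}=\{j:\tilde\theta^{(j)}_{\mathbb{I},n}\ne0\}$.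 $\tilde\Theta_n=\{\theta\in\Theta:\theta^{(j)}=0\text{ for all }j\text{ with }\tilde\theta^{(j)}_{\mathbb{I},n}=0\}$, and the P-O estimator $\check\theta_n\in\tilde\Theta_n$ satisfies $\mathbb{F}_n(\check\theta_n)=\inf_{\theta\in\tilde\Theta_n}\mathbb{F}_n(\theta)$. *)

(* Defs.v *)
From HB Require Import structures.
From mathcomp Require Export all_boot all_order all_algebra.
From mathcomp Require Export all_classical all_reals all_analysis.

Set Implicit Arguments.
Unset Strict Implicit.
Unset Printing Implicit Defensive.

Import Order.TTheory GRing.Theory Num.Theory.
Import numFieldNormedType.Exports.

Local Open Scope classical_set_scope.
Local Open Scope ring_scope.

Section Linear.
Context {R : realType}.

Definition enorm n (x : 'cV[R]_n) : R := Num.sqrt (\sum_i x i 0 ^+ 2).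

Definition psd n (A : 'M[R]_n) : Prop :=
  A^T = A /\ forall x : 'cV[R]_n, 0 <= (x^T *m A *m x) 0 0.

Definition posdef n (A : 'M[R]_n) : Prop :=
  A^T = A /\ forall x : 'cV[R]_n, x != 0 -> 0 < (x^T *m A *m x) 0 0.

(* The columns of the lower triangle of [A], stacked from left to right. *)
Definition vech n (A : 'M[R]_n) : 'cV[R]_((n * n.+1)./2) :=
  \col_k nth 0
    [seq A i j | j <- enum 'I_n, i <- [seq i : 'I_n <- enum 'I_n | (j <= i)%N]] k.

Definition active_set q (theta : 'rV[R]_q) : {set 'I_q} :=
  [set j | theta 0 j != 0]%SET.

End Linear.

Section Calculus.
Context {R : realType}.

Definition is_minimizer (V : Type) (A : set V) (f : V -> R) (x : V) : Prop :=
  A x /\ forall y, A y -> f x <= f y.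

Fixpoint iter_partial k (f : 'cV[R]_k -> R) (js : seq 'I_k) : 'cV[R]_k -> R :=
  if js is j :: js' then 'D_(delta_mx j 0) (iter_partial f js') else f.

Definition polynomial_growth k (f : 'cV[R]_k -> R) : Prop :=
  exists C : R, exists m : nat, forall x, `|f x| <= C * (1 + enorm x) ^+ m.

(* All iterated partial derivatives of order at most 4, in any order of
   differentiation, exist, are continuous and have polynomial growth. *)
Definition C4_polynomial_growth k (f : 'cV[R]_k -> R) : Prop :=
  forall js : seq 'I_k, (size js <= 4)%N ->
    [/\ continuous (iter_partial f js),
        ((size js < 4)%N ->
          forall x j, derivable (iter_partial f js) x (delta_mx j 0)) &
        polynomial_growth (iter_partial f js)].

Definition regular_drift k (B : 'cV[R]_k -> 'cV[R]_k) : Prop :=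
  (exists L : R, forall x y, enorm (B x - B y) <= L * enorm (x - y)) /\
  (forall i, C4_polynomial_growth (fun x => B x i 0)).

Definition hessian q (f : 'rV[R]_q -> R) (x : 'rV[R]_q) : 'M[R]_q :=
  \matrix_(i, j) 'D_(delta_mx 0 i) ('D_(delta_mx 0 j) f) x.

End Calculus.

Section ChiSquared.
Context {R : realType}.

Definition Gamma (a : R) : R :=
  \int[lebesgue_measure]_(x in `]0, +oo[) (x `^ (a - 1) * expR (- x)).

Definition chi2_pdf (r : nat) (x : R) : R :=
  if 0 < x
  then x `^ (r%:R / 2 - 1) * expR (- (x / 2))
       / (2 `^ (r%:R / 2) * Gamma (r%:R / 2))
  else 0.

(* The point x >= 0 with P(chi2_r > x) = alpha, which exists and is unique for
   r > 0 and 0 < alpha < 1. For r = 0 the value is 0, the upper point of the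
   point mass at 0. *)
Definition chi2_upper (r : nat) (alpha : R) : R :=
  xget 0 [set x | 0 <= x /\
    (\int[lebesgue_measure]_(y in `]x, +oo[) (chi2_pdf r y)%:E = alpha%:E)%E].

End ChiSquared.

Section Processes.
Context {d : measure_display} {Om : measurableType d} {R : realType}.
Variable P : probability Om R.

Definition random_matrix m n (Z : Om -> 'M[R]_(m, n)) : Prop :=
  forall i j, measurable_fun [set: Om] (fun w => Z w i j).

(* Each [G i] is meant to contain the full event (e.g. a sigma-algebra), so that
   the product rule over all indices contains the one over any subfamily. *)
Definition independent n (G : 'I_n -> set (set Om)) : Prop :=
  forall A : 'I_n -> set Om, (forall i, G i (A i)) ->
    (P (\bigcap_i A i) = \prod_(i < n) P (A i))%E.

(* sigma-algebra generated by the coordinates j in J of (W_t), t >= 0 *)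
Definition sigma_process r (W : R -> Om -> 'cV[R]_r) (J : set 'I_r) :
    set (set Om) :=
  <<s [set A | exists t j (C : set R), [/\ 0 <= t, J j, measurable C &
         A = (fun w => W t w j 0) @^-1` C]] >>.

Definition standard_wiener1 (W : R -> Om -> R) : Prop :=
  [/\ forall t, 0 <= t -> measurable_fun [set: Om] (W t),
      {ae P, forall w, W 0 w = 0},
      {ae P, forall w, {within `[0, +oo[, continuous (W ^~ w)}},
      (forall s t, 0 <= s -> s < t -> forall C : set R, measurable C ->
         P ((fun w => W t w - W s w) @^-1` C)
         = normal_prob 0 (Num.sqrt (t - s)) C) &
      (forall n (t : nat -> R), 0 <= t 0%N ->
         (forall i, t i <= t i.+1) ->
         independent (fun i : 'I_n =>
           g_sigma_algebra_preimage (fun w => W (t i.+1) w - W (t i) w)))].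

Definition standard_wiener r (W : R -> Om -> 'cV[R]_r) : Prop :=
  (forall j, standard_wiener1 (fun t w => W t w j 0)) /\
  independent (fun j => sigma_process W [set j]).

(* dY = B(Y) dt + S dW on [0, T], Y_0 = c. The noise is additive, so the
   stochastic integral of S is S W_t and the equation is pathwise. For a
   Lipschitz B the continuous solution is pathwise unique, hence adapted to the
   completed filtration of W. *)
Definition sde_solution (T : R) k r (B : 'cV[R]_k -> 'cV[R]_k)
    (S : 'M[R]_(k, r)) (c : 'cV[R]_k) (W : R -> Om -> 'cV[R]_r)
    (Y : R -> Om -> 'cV[R]_k) : Prop :=
  (forall t, 0 <= t <= T -> random_matrix (Y t)) /\
  {ae P, forall w, {within `[0, T], continuous (Y ^~ w)} /\
     forall t, 0 <= t <= T -> forall i,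
       Y t w i 0 = c i 0
         + \int[lebesgue_measure]_(s in `[0, t]) B (Y s w) i 0
         + (S *m W t w) i 0}.

Definition bounded_moments (T : R) k (Y : R -> Om -> 'cV[R]_k) : Prop :=
  forall l : R, 0 <= l ->
    (ereal_sup [set 'E_P[fun w => (enorm (Y t w) `^ l)%R]
               | t in [set t : R | (0 <= t <= T)%R]] < +oo)%E.

End Processes.

Section Sem.

Record sem (E : Type) (p1 p2 k1 k2 : nat) := Sem {
  Lx1 : 'M[E]_(p1, k1);
  Lx2 : 'M[E]_(p2, k2);
  Gam : 'M[E]_(k2, k1);
  Psi : 'M[E]_k2;
  Sxx : 'M[E]_k1;
  Sdd : 'M[E]_p1;
  See : 'M[E]_p2;
  Szz : 'M[E]_k2 }.

Definition map_sem (E E' : Type) (f : E -> E') p1 p2 k1 k2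
    (m : sem E p1 p2 k1 k2) : sem E' p1 p2 k1 k2 :=
  Sem (map_mx f (Lx1 m)) (map_mx f (Lx2 m)) (map_mx f (Gam m))
      (map_mx f (Psi m)) (map_mx f (Sxx m)) (map_mx f (Sdd m))
      (map_mx f (See m)) (map_mx f (Szz m)).

Definition sem_entry (E : Type) p1 p2 k1 k2 (m : sem E p1 p2 k1 k2) (e : E) :
    Prop :=
  (exists i j, Lx1 m i j = e) \/ (exists i j, Lx2 m i j = e) \/
  (exists i j, Gam m i j = e) \/ (exists i j, Psi m i j = e) \/
  (exists i j, Sxx m i j = e) \/ (exists i j, Sdd m i j = e) \/
  (exists i j, See m i j = e) \/ (exists i j, Szz m i j = e).

Context {R : realType}.

Definition sem_Sigma p1 p2 k1 k2 (m : sem R p1 p2 k1 k2) : 'M[R]_(p1 + p2) :=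
  let iPsi := invmx (Psi m) in
  let S11 := Lx1 m *m Sxx m *m (Lx1 m)^T + Sdd m in
  let S12 := Lx1 m *m Sxx m *m (Gam m)^T *m iPsi^T *m (Lx2 m)^T in
  let S22 := Lx2 m *m iPsi *m (Gam m *m Sxx m *m (Gam m)^T + Szz m)
               *m iPsi^T *m (Lx2 m)^T + See m in
  block_mx S11 S12 S12^T S22.

Definition admissible p1 p2 k1 k2 (m : sem R p1 p2 k1 k2) : Prop :=
  [/\ \rank (Lx1 m) = k1,
      (forall i, (1%:M - Psi m) i i = 0),
      Psi m \in unitmx,
      psd (Sxx m) /\ psd (Szz m) &
      posdef (Sdd m) /\ posdef (See m)].

Definition true_sem p1 p2 k1 k2 r1 r2 r3 r4 (L1 : 'M[R]_(p1, k1))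
    (L2 : 'M[R]_(p2, k2)) (G : 'M[R]_(k2, k1)) (B : 'M[R]_k2)
    (S1 : 'M[R]_(k1, r1)) (S2 : 'M[R]_(p1, r2)) (S3 : 'M[R]_(p2, r3))
    (S4 : 'M[R]_(k2, r4)) : sem R p1 p2 k1 k2 :=
  Sem L1 L2 G (1%:M - B)
      (S1 *m S1^T) (S2 *m S2^T) (S3 *m S3^T) (S4 *m S4^T).

(* A pattern describes the parametrization: an entry [inl c] is the known
   constant c, an entry [inr j] is the j-th coordinate of theta. *)
Definition pattern q p1 p2 k1 k2 := sem (R + 'I_q)%type p1 p2 k1 k2.

Definition sem_at q p1 p2 k1 k2 (m : pattern q p1 p2 k1 k2)
    (theta : 'rV[R]_q) : sem R p1 p2 k1 k2 :=
  map_sem (fun e => match e with inl c => c | inr j => theta 0 j end) m.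

(* Every coordinate of theta is an entry of the model, and the two symmetric
   off-diagonal entries of a covariance matrix are the same datum. *)
Definition well_parametrized q p1 p2 k1 k2 (m : pattern q p1 p2 k1 k2) : Prop :=
  (forall j : 'I_q, sem_entry m (inr j)) /\
  [/\ (Sxx m)^T = Sxx m, (Sdd m)^T = Sdd m, (See m)^T = See m &
      (Szz m)^T = Szz m].

End Sem.

Section Estimation.
Context {R : realType}.

Definition contrast p (Q S : 'M[R]_p) : R :=
  ln (\det S) - ln (\det Q) + \tr (invmx S *m Q) - p%:R.

Definition empirical_contrast p (Q S : 'M[R]_p) : R :=
  if Q \in unitmx then contrast Q S else enorm (vech Q - vech S) ^+ 2.

(* Only used for n > 0. *)
Definition realized_cov (Om : Type) p (T : R) (X : R -> Om -> 'cV[R]_p)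
    (n : nat) (w : Om) : 'M[R]_p :=
  let h := T / n%:R in
  T^-1 *: \sum_(1 <= i < n.+1)
    ((X (i%:R * h) w - X ((i%:R - 1) * h) w)
     *m (X (i%:R * h) w - X ((i%:R - 1) * h) w)^T).

Definition adaptive_weight (l1 l2 gamma delta x : R) : R :=
  if delta <= `|x| then l1 * `|x| `^ (- gamma) else l2.

Definition penalized q (kappa theta_hat theta : 'rV[R]_q) : R :=
  \sum_j (theta 0 j - theta_hat 0 j) ^+ 2
  + \sum_j kappa 0 j * `|theta 0 j|.

End Estimation.

(* Main.v *)
(* Only theta_check in Theta matters. The threshold takes finitely many values, so
   it is enough that F_n stays above a positive constant on the whole of Theta with
   probability tending to one, since F_n is then multiplied by n.

   The realized covariance tends to Sigma_0 in probability: each latent process is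
   a multiple of its Wiener process plus a path that is Lipschitz on [0, T], and the
   Lipschitz part does not contribute to the quadratic variation (the paths of the
   Wiener processes being uniformly continuous). The realized covariance of the
   Wiener processes tends to the identity by a second moment computation.

   Under H1 the contrast at Sigma_0 is at least U(theta_bar) > 0, because
   ln det M <= tr M - p for positive definite M, with equality only at the identity.
   The inverses of Sigma(theta) are bounded on the compact set Theta, so the contrast
   is close to its value at Sigma_0, uniformly in theta, when Q is close to Sigma_0. *)

Require Import Defs.
From mathcomp Require Import measurable_realfun ring lra.

Set Implicit Arguments.
Unset Strict Implicit.
Unset Printing Implicit Defensive.

Import Order.TTheory GRing.Theory Num.Theory.
Import numFieldNormedType.Exports.

Local Open Scope classical_set_scope.
Local Open Scope ring_scope.

(** * Positive definite matrices and the contrast *)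

Section PositiveDefinite.
Context {R : realType}.

(** Positive definite matrices are handled by induction on the dimension through a single $LDL^\top$
    step, rather than by eigenvalues: the step yields the whitening matrix, the sign of the
    determinant and the trace inequality with its equality case. In the difference of two contrasts
    $\ln\det\Sigma(\theta)$ cancels, so only a one-sided estimate of $\ln\det Q$ and of a trace is
    needed, uniformly in $\theta$. The normal moments come from exponential tilts: a tilted normal
    density is a multiple of another normal density, so its integral is known, and the moments
    follow by elementary bounds on the exponential. A crude fourth moment is enough, the target
    being a variance of order $1/n$. The four noises are stacked into one vector $W$ with pairwise
    independent coordinates, and the observed process is $KW$ plus a Lipschitz path, with
    $KK^\top=\Sigma_0$. The Lipschitz constant is random, so the comparison is made path by path and
    only then turned into convergence in probability. Monotonicity of the probability is applied to
    measurable sets, so the statistic and its random threshold are traced through determinant,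
    inverse, [vech] and active set. *)

Lemma posdef_congr n (U A : 'M[R]_n) :
  U \in unitmx -> posdef A -> posdef (U *m A *m U^T).
Proof.
move=> uU [sA pA]; split; first by rewrite !trmx_mul trmxK sA mulmxA.
move=> x x0; have -> : x^T *m (U *m A *m U^T) *m x
  = (U^T *m x)^T *m A *m (U^T *m x) by rewrite trmx_mul trmxK !mulmxA.
apply: pA; apply: contra x0 => /eqP Ux0.
have uUT : U^T \in unitmx by rewrite unitmx_tr.
by rewrite -(mulKmx uUT x) Ux0 mulmx0.
Qed.

Lemma posdef_congrV n (U A : 'M[R]_n) :
  U \in unitmx -> posdef (U *m A *m U^T) -> posdef A.
Proof.
move=> uU pA; rewrite (_ : A = invmx U *m (U *m A *m U^T) *m (invmx U)^T).
  by apply: posdef_congr; rewrite // unitmx_inv.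
by rewrite trmx_inv !mulmxA mulVmx // mul1mx mulmxK // unitmx_tr.
Qed.

Lemma posdef_block_diag m n (A : 'M[R]_m) (B : 'M[R]_n) :
  posdef (block_mx A 0 0 B) <-> posdef A /\ posdef B.
Proof.
have quadE (x : 'cV[R]_m) (y : 'cV[R]_n) :
    (col_mx x y)^T *m block_mx A 0 0 B *m col_mx x y
    = x^T *m A *m x + y^T *m B *m y.
  by rewrite tr_col_mx mul_row_block !mulmx0 addr0 add0r mul_row_col.
split=> [[+ pAB]|[[sA pA] [sB pB]]].
- rewrite tr_block_mx => /eq_block_mx [sA _ _ sB].
  split; split=> // x x0.
  + have := pAB (col_mx x 0); rewrite quadE !mulmx0 addr0; apply.
    by apply: contra x0; rewrite col_mx_eq0 => /andP[].
  + have := pAB (col_mx 0 x); rewrite quadE !mulmx0 add0r; apply.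
    by apply: contra x0; rewrite col_mx_eq0 => /andP[].
- split; first by rewrite tr_block_mx sA sB !trmx0.
  move=> z; rewrite -[z]vsubmxK quadE mxE col_mx_eq0 negb_and.
  set x := usubmx z; set y := dsubmx z.
  have A0 : 0 <= (x^T *m A *m x) 0 0.
    by have [->|/pA/ltW//] := eqVneq x 0; rewrite mulmx0 mxE.
  have B0 : 0 <= (y^T *m B *m y) 0 0.
    by have [->|/pB/ltW//] := eqVneq y 0; rewrite mulmx0 mxE.
  by move=> /orP[/pA xA|/pB yB]; [exact: ltr_wpDr|exact: ltr_wpDl].
Qed.

(** One step of the $LDL^\top$ factorization: pivot [a], entries [a *: v] below it in the first
    column, Schur complement [N]. *)
Definition ldl_mx n (a : R) (v : 'cV[R]_n) (N : 'M[R]_n) : 'M[R]_(1 + n) :=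
  block_mx 1%:M 0 v 1%:M *m block_mx a%:M 0 0 N *m (block_mx 1%:M 0 v 1%:M)^T.

Lemma det_ldl_mx n (a : R) (v : 'cV[R]_n) (N : 'M[R]_n) :
  \det (ldl_mx a v N) = a * \det N.
Proof.
rewrite !det_mulmx det_tr det_lblock !det1 !mulr1 mul1r.
by rewrite det_ublock det_scalar1.
Qed.

Lemma mxtrace_ldl_mx n (a : R) (v : 'cV[R]_n) (N : 'M[R]_n) :
  \tr (ldl_mx a v N) = a + (a * \tr (v *m v^T) + \tr N).
Proof.
rewrite /ldl_mx tr_block_mx !trmx1 trmx0 !mulmx_block.
rewrite !(mul1mx, mulmx1, mul0mx, mulmx0, addr0, add0r) mxtrace_block.
by rewrite mul_mx_scalar -scalemxAl linearD linearZ/= mxtrace_scalar mulr1n.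
Qed.

Lemma ldl_mx1 n : ldl_mx 1 0 1%:M = 1%:M :> 'M[R]_(1 + n).
Proof. by rewrite /ldl_mx -!scalar_mx_block trmx1 !mulmx1. Qed.

(** The pivot is positive by testing on the first basis vector. The block diagonal matrix of pivot
    and Schur complement is congruent to [M], so [N] inherits positive definiteness. *)
Lemma posdef_ldl n (M : 'M[R]_(1 + n)) : posdef M ->
  exists (a : R) (v : 'cV[R]_n) (N : 'M[R]_n),
    [/\ 0 < a, posdef N & M = ldl_mx a v N].
Proof.
move=> pM; have [sM _] := pM.
pose a := M 0 0.
pose v : 'cV[R]_n := a^-1 *: dlsubmx M.
have a_gt0 : 0 < a.
  have [_ /(_ (delta_mx 0 0))] := pM.
  rewrite trmx_delta -rowE -colE !mxE; apply.
  by apply/eqP => /matrixP/(_ 0 0); rewrite !mxE !eqxx => /eqP; rewrite oner_eq0.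
have a0 : a != 0 by rewrite gt_eqF.
pose N : 'M[R]_n := drsubmx M - a *: (v *m v^T).
have ME : M = ldl_mx a v N.
  rewrite /ldl_mx tr_block_mx !trmx1 trmx0 !mulmx_block.
  rewrite !(mul1mx, mulmx1, mul0mx, mulmx0, addr0, add0r).
  rewrite mul_mx_scalar mul_scalar_mx -scalemxAl addrC subrK.
  rewrite -{1}[M]submxK; congr block_mx.
  - apply/matrixP => i j; rewrite !ord1 !mxE eqxx mulr1n /a.
    by congr (M _ _); apply/val_inj.
  - rewrite /v linearZ /= scalerA mulfV// scale1r -[in LHS]sM.
    by apply/matrixP => i j; rewrite !mxE.
  - by rewrite /v scalerA mulfV// scale1r.
exists a, v, N; split => //.
have uL : (block_mx 1%:M 0 v 1%:M : 'M[R]_(1 + n)) \in unitmx.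
  by rewrite unitmxE det_lblock !det1 mulr1 unitr1.
have : posdef (block_mx a%:M 0 0 N : 'M[R]_(1 + n)).
  by apply: (posdef_congrV uL); rewrite -/(ldl_mx a v N) -ME.
by case/posdef_block_diag.
Qed.

(** Induction on the dimension: undo the unit triangular factor, then rescale the pivot by the
    inverse of its square root and the Schur complement by its own whitening matrix. [C] plays the
    part of an inverse square root without having to be symmetric. *)
Lemma posdef_whitening n (S : 'M[R]_n) : posdef S ->
  exists2 C : 'M[R]_n, C \in unitmx & C *m S *m C^T = 1%:M.
Proof.
elim: n S => [|n IHn] S.
  by exists 1%:M; rewrite ?unitmx1//; apply/matrixP => -[].
move=> /(@posdef_ldl n)[a [v [N [a_gt0 /IHn[C uC CN] ->]]]].
pose L : 'M[R]_(1 + n) := block_mx 1%:M 0 v 1%:M.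
pose D : 'M[R]_(1 + n) := block_mx (Num.sqrt a)^-1%:M 0 0 C.
have uL : L \in unitmx by rewrite unitmxE det_lblock !det1 mulr1 unitr1.
have sa : Num.sqrt a != 0 by rewrite gt_eqF// sqrtr_gt0.
have uD : D \in unitmx.
  rewrite unitmxE det_ublock det_scalar1 unitrM -unitmxE uC andbT.
  by rewrite unitfE invr_eq0.
exists (D *m invmx L); first by rewrite unitmx_mul uD unitmx_inv.
rewrite /ldl_mx -/L trmx_mul !mulmxA mulmxKV// trmx_inv mulmxK ?unitmx_tr//.
suff DE : D *m block_mx a%:M 0 0 N *m D^T = 1%:M by exact: DE.
rewrite /D tr_block_mx !trmx0 tr_scalar_mx !mulmx_block.
rewrite !(mul0mx, mulmx0, addr0, add0r) CN -!scalar_mxM.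
rewrite -{2}(sqr_sqrtr (ltW a_gt0)) expr2 mulrA mulVf// mul1r mulfV//.
by rewrite -scalar_mx_block.
Qed.

Lemma posdef_det_gt0 n (S : 'M[R]_n) : posdef S -> 0 < \det S.
Proof.
move=> /posdef_whitening[C uC /(congr1 determinant)].
rewrite !det_mulmx det_tr det1 mulrAC -expr2 => e1.
have C2 : 0 < (\det C) ^+ 2 by rewrite exprn_even_gt0//= -unitfE -unitmxE.
by rewrite -(pmulr_rgt0 _ C2) e1.
Qed.

Lemma posdef_unitmx n (S : 'M[R]_n) : posdef S -> S \in unitmx.
Proof. by move=> /posdef_det_gt0 S0; rewrite unitmxE unitfE gt_eqF. Qed.

Lemma ln_lt_subr1 (x : R) : 0 < x -> x != 1 -> ln x < x - 1.
Proof.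
move=> x0 x1; rewrite ltrBrDr addrC.
have lx0 : ln x != 0 by rewrite ln_eq0.
by have := expR_gt1Dx lx0; rewrite lnK.
Qed.

(** Along one $LDL^\top$ step, $\ln\det M=\ln a+\ln\det N$ and
    $\operatorname{tr}M=a+a|v|^2+\operatorname{tr}N$, so the induction rests on $\ln a\le a-1$ and
    $a|v|^2\ge0$. Equality forces $a=1$, $N=1$ and then $v=0$. *)
Lemma posdef_ln_det n (M : 'M[R]_n) : posdef M ->
  ln (\det M) <= \tr M - n%:R ?= iff (M == 1%:M).
Proof.
elim: n M => [|n IHn] M.
  move=> _; rewrite det_mx00 ln1 /mxtrace big_ord0 subrr.
  by split=> //; rewrite eqxx; apply/esym/eqP/matrixP => -[].
move=> /(@posdef_ldl n)[a [v [N [a_gt0 pN ME]]]].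
have [IHle IHeq] := IHn _ pN.
have N_gt0 := posdef_det_gt0 pN.
have v2_ge0 : 0 <= \tr (v *m v^T).
  by rewrite mxtrace_mulC mxtrace_mulC; apply: sumr_ge0 => i _;
    rewrite mxE; apply: sumr_ge0 => j _; rewrite !mxE -expr2 sqr_ge0.
have detM : \det M = a * \det N.
  by rewrite ME -[RHS](det_ldl_mx a v).
have trM : \tr M = a + (a * \tr (v *m v^T) + \tr N).
  by rewrite ME -[RHS](mxtrace_ldl_mx a v N).
have -> : ln (\det M) = ln a + ln (\det N).
  by rewrite detM lnM// posrE.
have lna : ln a <= a - 1.
  have [->|/(ln_lt_subr1 a_gt0)/ltW//] := eqVneq a 1.
  by rewrite ln1 subrr.
have av : 0 <= a * \tr (v *m v^T) by rewrite mulr_ge0// ltW.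
rewrite trM -natr1; split; first lra.
apply/eqP/eqP => [e|M1].
- have a1 : a = 1.
    apply/eqP; apply: contraT => /(ln_lt_subr1 a_gt0); lra.
  have N1 : N = 1%:M by apply/eqP; rewrite -IHeq; apply/eqP; lra.
  have v2 : \tr (v *m v^T) = 0.
    by move: e; rewrite a1 N1 ln1 det1 ln1 mxtrace1 mul1r; lra.
  have v0 : v = 0.
    apply/matrixP => i j; rewrite ord1 mxE; apply/eqP.
    move: v2; rewrite /mxtrace => /eqP.
    rewrite psumr_eq0 => [/allP/(_ i)|k _]; last first.
      by rewrite mxE; apply: sumr_ge0 => l _; rewrite !mxE -expr2 sqr_ge0.
    by rewrite mem_index_enum mxE big_ord1 !mxE mulf_eq0 orbb => /(_ isT).
  by rewrite ME a1 N1 v0 -[RHS](ldl_mx1 n).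
- have := detM; rewrite M1 det1 => e1.
  have := trM; rewrite M1 mxtrace1 -natr1 => e2.
  have := lnM (x:=a) (y:=\det N); rewrite !posrE -e1 ln1 => /(_ a_gt0 N_gt0) e3.
  lra.
Qed.

(** If $CSC^\top=1$ and $M=CQC^\top$, the contrast equals $\operatorname{tr}M-n-\ln\det M$; it
    vanishes only for $M=1$, which means $Q=C^{-1}C^{-\top}=S$. *)
Lemma contrast_gt0 n (Q S : 'M[R]_n) :
  posdef Q -> posdef S -> Q <> S -> 0 < contrast Q S.
Proof.
move=> pQ pS QS.
have [C uC CS] := posdef_whitening pS.
have uCT : C^T \in unitmx by rewrite unitmx_tr.
have whitenK A : C *m A *m C^T = 1%:M -> A = invmx C *m invmx C^T.
  move=> CA; rewrite -[invmx C in RHS]mulmx1 -CA !mulmxA mulVmx// mul1mx.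
  by rewrite mulmxK.
have SE := whitenK _ CS.
have iSE : invmx S = C^T *m C.
  have uS := posdef_unitmx pS.
  have CCS : C^T *m C *m S = 1%:M by rewrite SE !mulmxA mulmxK// mulmxV.
  by rewrite -[RHS](mulmxK uS) CCS mul1mx.
have pM := posdef_congr uC pQ.
have [le eq] := posdef_ln_det pM.
have trE : \tr (invmx S *m Q) = \tr (C *m Q *m C^T).
  by rewrite iSE (mxtrace_mulC (C *m Q)) mulmxA.
have dC : 0 < (\det C) ^+ 2 by rewrite exprn_even_gt0//= -unitfE -unitmxE.
have dQ := posdef_det_gt0 pQ; have dS := posdef_det_gt0 pS.
have e1 : (\det C) ^+ 2 * \det S = 1.
  by rewrite -(det1 _ n) -CS !det_mulmx det_tr expr2 mulrAC.
have e2 : ln (\det (C *m Q *m C^T)) = ln (\det Q) - ln (\det S).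
  rewrite !det_mulmx det_tr mulrAC -expr2 lnM ?posrE//.
  by have := lnM (x:=(\det C) ^+ 2) (y:=\det S);
    rewrite !posrE e1 ln1 => /(_ dC dS); lra.
rewrite /contrast trE -(subr0 (ln (\det S) - _ + _ - _)).
suff : ln (\det (C *m Q *m C^T)) < \tr (C *m Q *m C^T) - n%:R by lra.
rewrite lt_neqAle le andbT eq; apply/eqP => M1; apply: QS.
by rewrite SE; apply: whitenK.
Qed.

Lemma psd_congr m n (A : 'M[R]_(m, n)) (S : 'M[R]_n) :
  psd S -> psd (A *m S *m A^T).
Proof.
move=> [sS pS]; split; first by rewrite !trmx_mul trmxK sS mulmxA.
by move=> x; have := pS (A^T *m x); rewrite trmx_mul trmxK !mulmxA.
Qed.

Lemma psd_gram m n (A : 'M[R]_(m, n)) : psd (A *m A^T).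
Proof.
split=> [|x]; first by rewrite trmx_mul trmxK.
rewrite -mulmxA -mulmxA mulmxA mxE; apply: sumr_ge0 => i _.
have -> : A^T *m x = (x^T *m A)^T by rewrite trmx_mul trmxK.
by rewrite [X in _ * X]mxE -expr2 sqr_ge0.
Qed.

Lemma posdef_psdD n (A B : 'M[R]_n) : psd A -> posdef B -> posdef (A + B).
Proof.
move=> [sA pA] [sB pB]; split; first by rewrite linearD /= sA sB.
by move=> x /pB xB; rewrite mulmxDr mulmxDl mxE ltr_wpDl.
Qed.

End PositiveDefinite.

(** * The covariance of the structural equation model *)

Section SemCovariance.
Context {R : realType} (p1 p2 k1 k2 : nat).
Implicit Type m : sem R p1 p2 k1 k2.

(** Coefficient of $\xi$ in the reduced form of the observed process, obtained by substituting
    $\eta=\Psi^{-1}(\Gamma\xi+\zeta)$; [zeta_loading] is the coefficient of $\zeta$. *)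
Definition xi_loading m : 'M[R]_(p1 + p2, k1) :=
  col_mx (Lx1 m) (Lx2 m *m invmx (Psi m) *m Gam m).

Definition zeta_loading m : 'M[R]_(p1 + p2, k2) :=
  col_mx 0 (Lx2 m *m invmx (Psi m)).

(** A sum of congruences of the latent covariances: positive definiteness can be read off, and the
    sum can be compared with the Gram matrix of the noise coefficients. *)
Lemma sem_SigmaE m : (Sxx m)^T = Sxx m ->
  sem_Sigma m = xi_loading m *m Sxx m *m (xi_loading m)^T
    + zeta_loading m *m Szz m *m (zeta_loading m)^T
    + block_mx (Sdd m) 0 0 (See m).
Proof.
move=> sS; rewrite /xi_loading /zeta_loading !tr_col_mx
  (mul_col_mx _ _ (Sxx m)) (mul_col_mx _ _ (Szz m)).
rewrite !mul_col_row !add_block_mx !trmx0 !(mul0mx, mulmx0, addr0).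
rewrite /sem_Sigma !trmx_mul !trmxK sS !mulmxA; congr block_mx.
by rewrite mulmxDr !mulmxDl !mulmxA.
Qed.

Lemma sem_Sigma_posdef m : psd (Sxx m) -> psd (Szz m) ->
  posdef (Sdd m) -> posdef (See m) -> posdef (sem_Sigma m).
Proof.
move=> xx zz dd ee; rewrite sem_SigmaE -?addrA; last by case: xx.
apply: posdef_psdD; first exact: psd_congr.
apply: posdef_psdD; first exact: psd_congr.
exact/posdef_block_diag.
Qed.

End SemCovariance.

(** * Continuity of matrix operations *)

Section EntrywiseConvergence.
Context {R : realType} {T : Type} (F : set_system T) {FF : Filter F}.

(** Entrywise limits along any filter reduce matrix continuity to finite sums, products and
    quotients of reals. *)
Definition mcvg m n (A : T -> 'M[R]_(m, n)) (L : 'M[R]_(m, n)) : Prop :=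
  forall i j, A x i j @[x --> F] --> L i j.

Lemma mcvgD m n (A B : T -> 'M[R]_(m, n)) LA LB :
  mcvg A LA -> mcvg B LB -> mcvg (fun x => A x + B x) (LA + LB).
Proof.
move=> cA cB i j; rewrite mxE.
by under eq_fun do rewrite mxE; apply: cvgD; [exact: cA|exact: cB].
Qed.

Lemma mcvg_tr m n (A : T -> 'M[R]_(m, n)) L : mcvg A L -> mcvg (fun x => (A x)^T) L^T.
Proof. by move=> cA i j; rewrite mxE; under eq_fun do rewrite mxE; exact: cA. Qed.

Lemma cvg_sumr (I : Type) (r : seq I) (f : I -> T -> R) (l : I -> R) :
  (forall i, f i x @[x --> F] --> l i) ->
  \sum_(i <- r) f i x @[x --> F] --> \sum_(i <- r) l i.
Proof. by move=> fl; apply: cvg_big => //; exact: add_continuous. Qed.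

Lemma cvg_prodr (I : Type) (r : seq I) (f : I -> T -> R) (l : I -> R) :
  (forall i, f i x @[x --> F] --> l i) ->
  \prod_(i <- r) f i x @[x --> F] --> \prod_(i <- r) l i.
Proof. by move=> fl; apply: cvg_big => //; exact: mul_continuous. Qed.

Lemma mcvgM m n k (A : T -> 'M[R]_(m, n)) (B : T -> 'M[R]_(n, k)) LA LB :
  mcvg A LA -> mcvg B LB -> mcvg (fun x => A x *m B x) (LA *m LB).
Proof.
move=> cA cB i j; rewrite mxE; under eq_fun do rewrite mxE.
by apply: cvg_sumr => l; apply: cvgM; [exact: cA|exact: cB].
Qed.

Lemma mcvg_det n (A : T -> 'M[R]_n) L :
  mcvg A L -> \det (A x) @[x --> F] --> \det L.
Proof.
move=> cA; apply: cvg_sumr => s; apply: cvgM; first exact: cvg_cst.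
by apply: cvg_prodr => i; exact: cA.
Qed.

Lemma mcvg_adj n (A : T -> 'M[R]_n) L :
  mcvg A L -> mcvg (fun x => \adj (A x)) (\adj L).
Proof.
move=> cA i j; rewrite mxE; under eq_fun do rewrite mxE.
apply: cvgM; first exact: cvg_cst.
apply: mcvg_det => k l; rewrite !mxE; under eq_fun do rewrite !mxE.
exact: cA.
Qed.

(** [invmx] returns its argument on singular matrices, so the adjugate formula holds only
    eventually, once the determinant is nonzero. *)
Lemma mcvg_inv n (A : T -> 'M[R]_n) L : L \in unitmx ->
  mcvg A L -> mcvg (fun x => invmx (A x)) (invmx L).
Proof.
move=> uL cA i j.
have dL : \det L != 0 by rewrite -unitfE -unitmxE.
have cd := mcvg_det cA.
have near_unit : \forall x \near F, A x \in unitmx.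
  have : \forall x \near F, \det (A x) != 0 by exact: (cvgr_neq0 _ cd).
  by apply: filterS => x; rewrite unitmxE unitfE.
apply: (@cvg_trans _ ((\det (A x))^-1 * \adj (A x) i j @[x --> F])).
  apply: near_eq_cvg; apply: filterS near_unit => x uA.
  by rewrite /invmx uA [RHS]mxE.
have -> : invmx L i j = (\det L)^-1 * \adj L i j by rewrite /invmx uL [LHS]mxE.
apply: cvgM; first exact: cvgV.
exact: mcvg_adj.
Qed.

Lemma mcvg_block m1 m2 n1 n2 (A : T -> 'M[R]_(m1, n1)) (B : T -> 'M[R]_(m1, n2))
    (C : T -> 'M[R]_(m2, n1)) (D : T -> 'M[R]_(m2, n2)) LA LB LC LD :
  mcvg A LA -> mcvg B LB -> mcvg C LC -> mcvg D LD ->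
  mcvg (fun x => block_mx (A x) (B x) (C x) (D x)) (block_mx LA LB LC LD).
Proof.
move=> cA cB cC cD i j; rewrite !mxE; under eq_fun do rewrite !mxE.
case: splitP => k _; rewrite !mxE; under eq_fun do rewrite !mxE.
- by case: splitP => l _; [exact: cA|exact: cB].
- by case: splitP => l _; [exact: cC|exact: cD].
Qed.

Lemma mcvg_sem_Sigma p1 p2 k1 k2 (m : T -> sem R p1 p2 k1 k2) (m0 : sem R p1 p2 k1 k2) :
  mcvg (fun x => Lx1 (m x)) (Lx1 m0) ->
  mcvg (fun x => Lx2 (m x)) (Lx2 m0) ->
  mcvg (fun x => Gam (m x)) (Gam m0) ->
  mcvg (fun x => Psi (m x)) (Psi m0) ->
  mcvg (fun x => Sxx (m x)) (Sxx m0) ->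
  mcvg (fun x => Sdd (m x)) (Sdd m0) ->
  mcvg (fun x => See (m x)) (See m0) ->
  mcvg (fun x => Szz (m x)) (Szz m0) ->
  Psi m0 \in unitmx ->
  mcvg (fun x => sem_Sigma (m x)) (sem_Sigma m0).
Proof.
move=> cLx1 cLx2 cGam cPsi cSxx cSdd cSee cSzz uPsi.
have ciPsi := mcvg_inv uPsi cPsi.
have c12 := mcvgM (mcvgM (mcvgM (mcvgM cLx1 cSxx) (mcvg_tr cGam)) (mcvg_tr ciPsi))
  (mcvg_tr cLx2).
apply: mcvg_block => //; last 2 first.
- exact: mcvg_tr c12.
- apply: mcvgD => //; apply: mcvgM (mcvg_tr cLx2); apply: mcvgM (mcvg_tr ciPsi).
  apply: mcvgM; first exact: mcvgM.
  by apply: mcvgD => //; apply: mcvgM (mcvg_tr cGam); exact: mcvgM.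
- by apply: mcvgD => //; apply: mcvgM (mcvg_tr cLx1); exact: mcvgM.
Qed.

End EntrywiseConvergence.

(** * Uniform lower bound of the contrast on the parameter set *)

Section UniformLowerBound.
Context {R : realType}.

Lemma mcvg_pattern q m n (A : 'M[R + 'I_q]_(m, n)) (theta : 'rV[R]_q) :
  let f (t : 'rV[R]_q) (e : R + 'I_q) :=
    match e with inl c => c | inr j => t 0 j end in
  mcvg (nbhs theta) (fun t => map_mx (f t) A) (map_mx (f theta) A).
Proof.
move=> f i j; rewrite mxE; under eq_fun do rewrite mxE.
by rewrite /f; case: (A i j) => [c|k]; [exact: cvg_cst|exact: coord_continuous].
Qed.

Lemma mcvg_sem_at q p1 p2 k1 k2 (model : @pattern R q p1 p2 k1 k2) theta :
  Psi (sem_at model theta) \in unitmx ->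
  mcvg (nbhs theta) (fun t => sem_Sigma (sem_at model t))
    (sem_Sigma (sem_at model theta)).
Proof. by move=> uPsi; apply: mcvg_sem_Sigma => //; exact: mcvg_pattern. Qed.

(** Each entry is continuous at the points of a compact set, hence bounded on it; the sum of the
    finitely many bounds serves every entry. *)
Lemma compact_entry_bound q m n (Theta : set 'rV[R]_q)
    (A : 'rV[R]_q -> 'M[R]_(m, n)) : compact Theta ->
  (forall theta, Theta theta -> mcvg (nbhs theta) A (A theta)) ->
  exists2 K : R, 0 <= K &
    forall theta, Theta theta -> forall i j, `|A theta i j| <= K.
Proof.
move=> cTheta cA.
have bij (ij : 'I_m * 'I_n) : exists K : R, 0 <= K /\
    forall theta, Theta theta -> `|A theta ij.1 ij.2| <= K.
  have : compact ((fun t => A t ij.1 ij.2 : R^o) @` Theta).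
    apply: continuous_compact => //; apply: continuous_in_subspaceT => t.
    by rewrite inE => /cA; exact.
  move=> /compact_bounded[M [_ /(_ (`|M| + 1))]].
  have M1 : M < `|M| + 1 by rewrite (le_lt_trans (ler_norm _))// ltrDl.
  move=> /(_ M1) bM; exists (`|M| + 1); split; first by rewrite addr_ge0.
  by move=> t Tt; apply: bM; exists t.
have [K KP] := choice bij.
exists (\sum_ij K ij); first by apply: sumr_ge0 => ij _; exact: (KP ij).1.
move=> t Tt i j; apply: le_trans ((KP (i, j)).2 t Tt) _.
rewrite (bigD1 (i, j))//= lerDl; apply: sumr_ge0 => ij _; exact: (KP ij).1.
Qed.

(** The loss [c] is split in two halves, one for $\ln\det Q$, continuous at [S0], and one for
    $\operatorname{tr}(S^{-1}(S_0-Q))$, which is linear in $Q$. The radius depends on [S] only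
    through [K]. Nonsingularity of [Q] selects the likelihood branch of [empirical_contrast]. *)
Lemma contrast_near n (S0 : 'M[R]_n) (K c : R) : posdef S0 -> 0 <= K -> 0 < c ->
  exists2 e : R, 0 < e & forall Q : 'M[R]_n, (forall i j, `|Q i j - S0 i j| < e) ->
    Q \in unitmx /\ forall S : 'M[R]_n, (forall i j, `|invmx S i j| <= K) ->
      contrast S0 S - c <= contrast Q S.
Proof.
move=> pS0 K0 c0; have dS0 := posdef_det_gt0 pS0.
have cdet : \det Q @[Q --> S0] --> \det S0.
  by apply: (@mcvg_det _ _ (nbhs S0) _ _ id) => i j; exact: coord_continuous.
have cln : ln (\det Q) @[Q --> S0] --> ln (\det S0).
  apply: (@cvg_comp _ _ _ (fun Q : 'M[R]_n => \det Q) (@ln R) _ _ _ cdet).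
  exact: continuous_ln.
have near_det : \forall Q \near S0, 0 < \det Q by exact: cvgr_gt cdet _ dS0.
have near_ln : \forall Q \near S0, `|ln (\det S0) - ln (\det Q)| < c / 2.
  by move/cvgrPdist_lt: cln; apply; rewrite divr_gt0.
have := @filterI _ (nbhs S0) _ _ _ near_det near_ln.
move=> /(_ (nbhs_filter _)) /nbhs_ballP[e /= e0 ballS0].
(* The trace is a sum of $n^2$ products, each at most [K] times the entrywise error; the added 1
   keeps the divisor positive. *)
pose N : R := n%:R * (n%:R * K) + 1.
have N0 : 0 < N by rewrite /N ltr_wpDl// !mulr_ge0.
exists (Num.min e (c / 2 / N)); first by rewrite lt_min e0 !divr_gt0.
move=> Q QS0.
have [/= dQ lnQ] : [set M | 0 < \det M] Q /\
    [set M | `|ln (\det S0) - ln (\det M)| < c / 2] Q.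
  apply: ballS0; split => // i j; rewrite /ball/= distrC.
  by have := QS0 i j; rewrite lt_min => /andP[].
split; first by rewrite unitmxE unitfE gt_eqF.
move=> S SK; rewrite /contrast.
have trE : \tr (invmx S *m S0) - \tr (invmx S *m Q) <= c / 2.
  rewrite -linearB /= -mulmxBr; apply: le_trans (ler_norm _) _.
  have -> : c / 2 = N * (c / 2 / N) by rewrite [RHS]mulrC mulfVK// lt0r_neq0.
  apply: (@le_trans _ _ (\sum_(i < n) \sum_(j < n) (K * (c / 2 / N)))).
    apply: le_trans (ler_norm_sum _ _ _) _; apply: ler_sum => i _.
    rewrite mxE; apply: le_trans (ler_norm_sum _ _ _) _; apply: ler_sum => j _.
    rewrite normrM ler_pM// !mxE distrC ltW//.
    by have := QS0 j i; rewrite lt_min => /andP[].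
  have sumE (x : R) : \sum_(i < n) x = n%:R * x.
    by rewrite sumr_const card_ord mulr_natl.
  have x0 : 0 <= c / 2 / N by rewrite !divr_ge0// ltW.
  by move: x0; rewrite !sumE; set x := c / 2 / N => x0; rewrite /N; lra.
have := ler_norm (ln (\det Q) - ln (\det S0)).
rewrite distrC; lra.
Qed.

End UniformLowerBound.

(** * Random matrices and the realized covariance *)

Section RandomMatrix.
Context {d : measure_display} {Om : measurableType d} {R : realType}.

(** A real power with exponent $-1$ is the inverse on nonnegative bases, whence
    $f^{-1}=f\cdot(f^2)^{-1}$; this also holds where $f=0$, because the inverse of 0 is 0. *)
Lemma measurable_funV (f : Om -> R) :
  measurable_fun setT f -> measurable_fun setT (fun w => (f w)^-1).
Proof.
move=> mf; rewrite (_ : (fun w => (f w)^-1) =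
    (fun w => f w * ((f w) ^+ 2) `^ (-1))); last first.
  apply/funext => w; rewrite powR_inv1 ?sqr_ge0// expr2 invfM.
  have [->|f0] := eqVneq (f w) 0; first by rewrite invr0 mul0r.
  by rewrite mulrA divff// mul1r.
apply: measurable_funM => //.
apply: (@measurableT_comp _ _ _ _ _ _ (fun x : R => x `^ (-1)) setT
  (fun w => f w ^+ 2)).
  exact: measurable_powR.
exact: measurable_funX.
Qed.

Lemma measurable_fun_ln (f : Om -> R) :
  measurable_fun setT f -> measurable_fun setT (fun w => ln (f w)).
Proof. by move=> mf; apply: (@measurableT_comp _ _ _ _ _ _ (@ln R) setT f). Qed.

Lemma random_matrix_cst m n (L : 'M[R]_(m, n)) :
  random_matrix (fun _ : Om => L).
Proof. by move=> i j; exact: measurable_cst. Qed.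

Lemma random_matrixD m n (A B : Om -> 'M[R]_(m, n)) :
  random_matrix A -> random_matrix B -> random_matrix (fun w => A w + B w).
Proof.
move=> mA mB i j; under eq_fun do rewrite mxE.
by apply: measurable_funD; [exact: mA|exact: mB].
Qed.

Lemma random_matrixB m n (A B : Om -> 'M[R]_(m, n)) :
  random_matrix A -> random_matrix B -> random_matrix (fun w => A w - B w).
Proof.
move=> mA mB i j; under eq_fun do rewrite !mxE.
by apply: measurable_funB; [exact: mA|exact: mB].
Qed.

Lemma random_matrixZ m n (c : R) (A : Om -> 'M[R]_(m, n)) :
  random_matrix A -> random_matrix (fun w => c *: A w).
Proof.
move=> mA i j; under eq_fun do rewrite mxE.
by apply: measurable_funM; [exact: measurable_cst|exact: mA].
Qed.

Lemma random_matrix_tr m n (A : Om -> 'M[R]_(m, n)) :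
  random_matrix A -> random_matrix (fun w => (A w)^T).
Proof. by move=> mA i j; under eq_fun do rewrite mxE; exact: mA. Qed.

Lemma random_matrixM m n k (A : Om -> 'M[R]_(m, n)) (B : Om -> 'M[R]_(n, k)) :
  random_matrix A -> random_matrix B -> random_matrix (fun w => A w *m B w).
Proof.
move=> mA mB i j; under eq_fun do rewrite mxE.
by apply: measurable_sum => l; apply: measurable_funM; [exact: mA|exact: mB].
Qed.

Lemma random_matrix_sum (I : Type) (r : seq I) m n (A : I -> Om -> 'M[R]_(m, n)) :
  (forall i, random_matrix (A i)) -> random_matrix (fun w => \sum_(i <- r) A i w).
Proof.
move=> mA i j; under eq_fun do rewrite summxE.
by apply: measurable_sum => l; exact: mA.
Qed.

Lemma measurable_det n (A : Om -> 'M[R]_n) :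
  random_matrix A -> measurable_fun setT (fun w => \det (A w)).
Proof.
move=> mA; apply: measurable_sum => s; apply: measurable_funM.
  exact: measurable_cst.
by apply: measurable_prod => i _; exact: mA.
Qed.

Lemma measurable_in_unitmx n (A : Om -> 'M[R]_n) :
  random_matrix A -> measurable_fun setT (fun w => A w \in unitmx).
Proof.
move=> mA; under eq_fun do rewrite unitmxE unitfE.
apply: measurableT_comp => //; apply: measurable_fun_eqr.
  exact: measurable_det.
exact: measurable_cst.
Qed.

Lemma random_matrix_inv n (A : Om -> 'M[R]_n) :
  random_matrix A -> random_matrix (fun w => invmx (A w)).
Proof.
move=> mA i j.
rewrite (_ : (fun w => _) = (fun w => if A w \in unitmx
    then (\det (A w))^-1 * \adj (A w) i j else A w i j)); last first.
  by apply/funext => w; rewrite /invmx; case: ifP => //; rewrite [LHS]mxE.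
apply: measurable_fun_ifT; [exact: measurable_in_unitmx| |exact: mA].
apply: measurable_funM; first exact/measurable_funV/measurable_det.
under eq_fun do rewrite mxE; apply: measurable_funM; first exact: measurable_cst.
apply: measurable_det => k l; under eq_fun do rewrite !mxE; exact: mA.
Qed.

Lemma random_matrix_block m1 m2 n1 n2 (A : Om -> 'M[R]_(m1, n1))
    (B : Om -> 'M[R]_(m1, n2)) (C : Om -> 'M[R]_(m2, n1))
    (D : Om -> 'M[R]_(m2, n2)) :
  random_matrix A -> random_matrix B -> random_matrix C -> random_matrix D ->
  random_matrix (fun w => block_mx (A w) (B w) (C w) (D w)).
Proof.
move=> mA mB mC mD i j; under eq_fun do rewrite !mxE.
case: splitP => k _; under eq_fun do rewrite !mxE.
- by case: splitP => l _; [exact: mA|exact: mB].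
- by case: splitP => l _; [exact: mC|exact: mD].
Qed.

Lemma measurable_mxtrace n (A : Om -> 'M[R]_n) :
  random_matrix A -> measurable_fun setT (fun w => \tr (A w)).
Proof. by move=> mA; apply: measurable_sum => i; exact: mA. Qed.

(** [vech] reads an entry off a list that depends on the outcome. Rewritten as a fixed list [L] of
    functions evaluated at the outcome, the entry at a given position is one coordinate function, or
    the default 0. *)
Lemma random_matrix_vech n (A : Om -> 'M[R]_n) :
  random_matrix A -> random_matrix (fun w => vech (A w)).
Proof.
move=> mA i j; under eq_fun do rewrite mxE.
pose L := [seq (fun w => A w i j) | j <- enum 'I_n,
  i <- [seq i : 'I_n <- enum 'I_n | (j <= i)%N]].
rewrite (_ : (fun w => _) = (fun w => nth 0 [seq g w | g <- L] i)); last first.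
  by apply/funext => w; rewrite /L map_allpairs.
have [iL|Li] := ltnP i (size L); last first.
  under eq_fun do rewrite nth_default ?size_map//.
  exact: measurable_cst.
under eq_fun do rewrite (nth_map (cst 0))//.
by have /allpairsPdep[a [b [_ _ ->]]] := mem_nth (cst 0) iL; exact: mA.
Qed.

Lemma measurable_empirical_contrast n (Q S : Om -> 'M[R]_n) :
  random_matrix Q -> random_matrix S ->
  measurable_fun setT (fun w => empirical_contrast (Q w) (S w)).
Proof.
move=> mQ mS; apply: measurable_fun_ifT; first exact: measurable_in_unitmx.
- apply: measurable_funB; last exact: measurable_cst.
  apply: measurable_funD.
    by apply: measurable_funB; apply: measurable_fun_ln; exact: measurable_det.
  by apply/measurable_mxtrace/random_matrixM => //; exact: random_matrix_inv.
- have sq (x : 'cV[R]_((n * n.+1)./2)) : enorm x ^+ 2 = \sum_i x i 0 ^+ 2.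
    by rewrite sqr_sqrtr// sumr_ge0// => i _; exact: sqr_ge0.
  under eq_fun do rewrite sq.
  apply: measurable_sum => i; apply: measurable_funX.
  by apply: (random_matrixB (random_matrix_vech mQ) (random_matrix_vech mS)).
Qed.

Lemma random_matrix_sem_Sigma p1 p2 k1 k2 q (model : @pattern R q p1 p2 k1 k2)
    (theta : Om -> 'rV[R]_q) :
  random_matrix theta -> random_matrix (fun w => sem_Sigma (sem_at model (theta w))).
Proof.
move=> mtheta.
have mmap m n (A : 'M[R + 'I_q]_(m, n)) : random_matrix (fun w => map_mx
    (fun e => match e with inl c => c | inr j => theta w 0 j end) A).
  move=> i j; under eq_fun do rewrite mxE.
  by case: (A i j) => [c|k]; [exact: measurable_cst|exact: mtheta].
have mPsi := random_matrix_inv (mmap _ _ (Psi model)).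
have m12 := random_matrixM (random_matrixM (random_matrixM
  (random_matrixM (mmap _ _ (Lx1 model)) (mmap _ _ (Sxx model)))
  (random_matrix_tr (mmap _ _ (Gam model)))) (random_matrix_tr mPsi))
  (random_matrix_tr (mmap _ _ (Lx2 model))).
have m11 := random_matrixD (random_matrixM (random_matrixM (mmap _ _ (Lx1 model))
  (mmap _ _ (Sxx model))) (random_matrix_tr (mmap _ _ (Lx1 model))))
  (mmap _ _ (Sdd model)).
have mLPsi := random_matrixM (mmap _ _ (Lx2 model)) mPsi.
have mG := random_matrixD (random_matrixM (random_matrixM (mmap _ _ (Gam model))
  (mmap _ _ (Sxx model))) (random_matrix_tr (mmap _ _ (Gam model))))
  (mmap _ _ (Szz model)).
have m22 := random_matrixD (random_matrixM (random_matrixM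
  (random_matrixM mLPsi mG) (random_matrix_tr mPsi))
  (random_matrix_tr (mmap _ _ (Lx2 model)))) (mmap _ _ (See model)).
exact: random_matrix_block m11 m12 (random_matrix_tr m12) m22.
Qed.

(** There are finitely many possible active sets: the function is the sum over [A] of [f A] times
    the indicator that the active set is [A], and this indicator is a product over the
    coordinates. *)
Lemma measurable_active_set q (theta : Om -> 'rV[R]_q) (f : {set 'I_q} -> R) :
  random_matrix theta -> measurable_fun setT (fun w => f (active_set (theta w))).
Proof.
move=> mtheta.
rewrite (_ : (fun w => _) = (fun w => \sum_(A : {set 'I_q}) f A *
    \prod_(j < q) ((theta w 0 j != 0) == (j \in A))%:R)); last first.
  apply/funext => w; rewrite (bigD1 (active_set (theta w)))//=.
  rewrite [X in _ * X]big1 ?mulr1 => [|j _]; last by rewrite inE eqxx.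
  rewrite big1 ?addr0// => A /eqP Aneq.
  have [j jA] : exists j, (theta w 0 j != 0) != (j \in A).
    apply/existsP; rewrite -negb_forall; apply/negP => /forallP e.
    by apply: Aneq; apply/setP => j; rewrite inE (eqP (e j)).
  by rewrite (bigD1 j)//= (negbTE jA) mul0r mulr0.
apply: measurable_sum => A; apply: measurable_funM; first exact: measurable_cst.
apply: measurable_prod => j _.
apply: (measurableT_comp (f := fun b : bool => b%:R : R)) => //.
apply: (measurableT_comp (f := fun b : bool => (~~ b) == (j \in A))) => //.
by apply: measurable_fun_eqr; [exact: mtheta|exact: measurable_cst].
Qed.

End RandomMatrix.

(** * Sampling grid, increments and realized covariance *)

Section RealizedCovariance.
Context {R : realType}.

Definition grid (T : R) (n i : nat) : R := i%:R * (T / n%:R).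

Lemma grid_in (T : R) n i : 0 <= T -> (i <= n)%N -> 0 <= grid T n i <= T.
Proof.
move=> T0 le_in; rewrite /grid mulr_ge0 ?divr_ge0//=.
have [->|n0] := eqVneq n 0%N; first by rewrite invr0 !mulr0.
have n0' : 0 < n%:R :> R by rewrite ltr0n lt0n.
by rewrite mulrCA ler_piMr// ler_pdivrMr// mul1r ler_nat.
Qed.

Lemma gridS (T : R) n i : grid T n i.+1 - grid T n i = T / n%:R.
Proof. by rewrite /grid -mulrBl -natr1 addrC addKr mul1r. Qed.

Definition increment (V : zmodType) (T : R) n (x : R -> V) (i : nat) : V :=
  x (grid T n i.+1) - x (grid T n i).

Lemma realized_covE (Om : Type) p (T : R) (X : R -> Om -> 'cV[R]_p) n w :
  realized_cov T X n w =
  T^-1 *: \sum_(i < n) (increment T n (X ^~ w) i *m (increment T n (X ^~ w) i)^T).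
Proof.
rewrite /realized_cov big_add1/= big_mkord; congr (_ *: _).
by apply: eq_bigr => i _; rewrite /increment /grid -natr1 addrK.
Qed.

Lemma random_matrix_realized_cov d (Om : measurableType d) p (T : R)
    (X : R -> Om -> 'cV[R]_p) n :
  0 <= T -> (forall t, 0 <= t <= T -> random_matrix (X t)) ->
  random_matrix (realized_cov T X n).
Proof.
move=> T0 mX; rewrite (_ : realized_cov T X n = fun w => T^-1 *: \sum_(i < n)
    (increment T n (X ^~ w) i *m (increment T n (X ^~ w) i)^T)); last first.
  by apply/funext => w; rewrite realized_covE.
apply/random_matrixZ/random_matrix_sum => i.
have mI : random_matrix (fun w => increment T n (X ^~ w) i).
  by apply: random_matrixB; apply/mX/grid_in => //; exact: ltnW.
by apply: random_matrixM => //; exact: random_matrix_tr.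
Qed.

Lemma realized_cov_mulmx (Om : Type) p r (T : R) (K : 'M[R]_(p, r))
    (W : R -> Om -> 'cV[R]_r) n w :
  realized_cov T (fun t w => K *m W t w) n w = K *m realized_cov T W n w *m K^T.
Proof.
rewrite !realized_covE -scalemxAr -scalemxAl mulmx_sumr mulmx_suml.
congr (_ *: _); apply: eq_bigr => i _.
by rewrite /increment -mulmxBr trmx_mul !mulmxA.
Qed.

End RealizedCovariance.

(** * Normal moments and independence *)

Section NormalMoments.
Context {R : realType}.
Local Notation mu := (@lebesgue_measure R).

(** The Radon-Nikodym derivative of the normal law and [normal_pdf] have the same integral over
    every measurable set, so they agree almost everywhere. *)
Lemma ge0_integral_normal_prob (m s : R) (f : R -> R) :
  (forall x, 0 <= f x) -> measurable_fun setT f ->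
  (\int[normal_prob m s]_x (f x)%:E
   = \int[mu]_x (f x * normal_pdf m s x)%:E)%E.
Proof.
move=> f0 mf.
have numu : normal_prob m s `<< mu := normal_prob_dominates m s.
rewrite -(Radon_Nikodym_SigmaFinite.change_of_variables numu)//;
  last exact/measurable_EFinP.
apply: ae_eq_integral => //.
- apply: emeasurable_funM; first exact/measurable_EFinP.
  exact: measurable_int (Radon_Nikodym_SigmaFinite.f_integrable numu).
- apply/measurable_EFinP/measurable_funM => //; exact: measurable_normal_pdf.
- under [X in ae_eq _ _ _ X]eq_fun do rewrite EFinM.
  apply: ae_eqe_mul2l; apply: integral_ae_eq => //.
  + exact: Radon_Nikodym_SigmaFinite.f_integrable.
  + apply/measurable_EFinP; exact: measurable_normal_pdf.
  + by move=> A _ mA; rewrite -Radon_Nikodym_SigmaFinite.f_integral.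
Qed.

(** Exponential tilting: if the weight turns the density into [c] times another normal density, the
    integral is [c], since the latter has mass 1. *)
Lemma integral_expR_normal (s m s' c : R) (g : R -> R) : 0 <= c ->
  measurable_fun setT g ->
  (forall x, expR (g x) * normal_pdf 0 s x = c * normal_pdf m s' x) ->
  (\int[normal_prob 0 s]_x (expR (g x))%:E = c%:E)%E.
Proof.
move=> c0 mg gE; rewrite ge0_integral_normal_prob; last 2 first.
- by move=> x; exact: expR_ge0.
- by apply: measurableT_comp.
under eq_integral do rewrite gE EFinM.
rewrite ge0_integralZl//; first by rewrite integral_normal_pdf mule1.
- apply/measurable_EFinP; exact: measurable_normal_pdf.
- by move=> x _; rewrite lee_fin normal_pdf_ge0.
Qed.

(** The tilted density is centered normal with deviation [s * phi], where $\varphi=(1+us^2)^{-1/2}$.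
    Since [phi] is given by its equation, [u] may be negative as long as $1+us^2>0$; the fourth
    moment relies on this. *)
Lemma integral_expR_sqr_normal (s u phi : R) : 0 < s -> 0 < phi ->
  phi ^+ 2 * (1 + u * s ^+ 2) = 1 ->
  (\int[normal_prob 0 s]_x (expR (- (u * x ^+ 2 / 2)))%:E = phi%:E)%E.
Proof.
move=> s0 phi0 phiE.
apply: (@integral_expR_normal s 0 (s * phi)); first exact: ltW.
  apply: measurableT_comp => //; apply: measurable_funM => //.
  by apply: measurable_funM => //; exact: measurable_funX.
have sn : s != 0 by rewrite gt_eqF.
have pn : phi != 0 by rewrite gt_eqF.
move=> x; rewrite !normal_pdfE ?mulf_neq0// /normal_peak /normal_fun subr0.
have pk : Num.sqrt ((s * phi) ^+ 2 * pi *+ 2) = phi * Num.sqrt (s ^+ 2 * pi *+ 2).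
  have -> : (s * phi) ^+ 2 * pi *+ 2 = phi ^+ 2 * (s ^+ 2 * pi *+ 2) by ring.
  by rewrite sqrtrM ?sqr_ge0// sqrtr_sqr gtr0_norm.
have ex : - x ^+ 2 / ((s * phi) ^+ 2 *+ 2)
    = - (u * x ^+ 2 / 2) + - x ^+ 2 / (s ^+ 2 *+ 2).
  transitivity (- x ^+ 2 / ((s * phi) ^+ 2 *+ 2) * (phi ^+ 2 * (1 + u * s ^+ 2))).
    by rewrite phiE mulr1.
  by field; rewrite sn pn.
rewrite pk ex expRD invfM !mulrA divff// mul1r.
by ring.
Qed.

(** Completing the square: the tilted density is normal with mean $ls^2$ and the same deviation. *)
Lemma integral_expR_normal_mgf (s l : R) : 0 < s ->
  (\int[normal_prob 0 s]_x (expR (l * x))%:E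
   = (expR (l ^+ 2 * s ^+ 2 / 2))%:E)%E.
Proof.
move=> s0; apply: (@integral_expR_normal s (l * s ^+ 2) s).
- exact: expR_ge0.
- exact: measurable_funM.
have sn : s != 0 by rewrite gt_eqF.
move=> x; rewrite !normal_pdfE// /normal_fun subr0 mulrCA [RHS]mulrCA -!expRD.
by congr (_ * expR _); field.
Qed.

(** From $e^{-y}\le1/(1+y)$ and $(1-y+y^2)(1+y)=1+y^3\ge1$. *)
Lemma expRN_le_quadratic (y : R) : 0 <= y -> expR (- y) <= 1 - y + y ^+ 2.
Proof.
move=> y0; rewrite expRN; have q := expR_ge1Dx y.
have p1 : 0 < 1 + y by lra.
apply: (@le_trans _ _ ((1 + y)^-1)); first by rewrite lef_pV2// posrE expR_gt0.
rewrite -div1r ler_pdivrMr//.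
have -> : (1 - y + y ^+ 2) * (1 + y) = 1 + y ^+ 3 by ring.
by rewrite lerDl exprn_ge0.
Qed.

Lemma integral_normal_prob1 (s : R) : (\int[normal_prob 0 s]_x 1%:E = 1)%E.
Proof.
rewrite integral_cst// mul1e.
exact: (@probability_setT _ _ _ (normal_prob 0 s)).
Qed.

(** With $y=x^2/(4s^2)$ one has $x^4=32s^4\cdot y^2/2\le32s^4e^y$, and $e^y$ has integral $\sqrt2$
    since $1+us^2=1/2$ for the chosen [u]. The constant 64 is $32\sqrt2$ rounded up. *)
Lemma integral_X4_normal (s : R) : 0 < s ->
  (\int[normal_prob 0 s]_x (x ^+ 4)%:E <= (64 * s ^+ 4)%:E)%E.
Proof.
move=> s0; have sn : s != 0 by rewrite gt_eqF.
pose u : R := - (2 * s ^+ 2)^-1.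
have int_u := @integral_expR_sqr_normal s u (Num.sqrt 2) s0.
have {}int_u : (\int[normal_prob 0 s]_x (expR (- (u * x ^+ 2 / 2)))%:E
    = (Num.sqrt 2)%:E)%E.
  by apply: int_u; rewrite ?sqrtr_gt0// sqr_sqrtr// /u; field.
have mE : measurable_fun [set: R] (fun x => expR (- (u * x ^+ 2 / 2))).
  apply: measurableT_comp => //; apply: measurableT_comp => //.
  by apply: measurable_funM => //; apply: measurable_funM => //; exact: measurable_funX.
apply: (@le_trans _ _ (\int[normal_prob 0 s]_x
    (32 * s ^+ 4 * expR (- (u * x ^+ 2 / 2)))%:E)%E).
  apply: ge0_le_integral => //.
  - by move=> x _; rewrite lee_fin exprn_even_ge0.
  - exact/measurable_EFinP/measurable_funX.
  - by apply/measurable_EFinP/measurable_funM.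
  move=> x _; rewrite lee_fin.
  set y := - _.
  have y0 : 0 <= y.
    rewrite /y /u mulNr mulNr opprK divr_ge0// mulr_ge0 ?sqr_ge0//.
    by rewrite invr_ge0 mulr_ge0// sqr_ge0.
  have -> : x ^+ 4 = 32 * s ^+ 4 * (y ^+ 2 / 2) by rewrite /y /u; field.
  rewrite ler_pM2l ?mulr_gt0 ?exprn_gt0//.
  have : 1 + y ^+ 2 / 2 <= expR y := expR_ge1Dxn 1 y0.
  lra.
under eq_integral do rewrite EFinM.
rewrite ge0_integralZl//.
- rewrite int_u -EFinM lee_fin; have -> : 64 * s ^+ 4 = 32 * s ^+ 4 * 2 by ring.
  rewrite ler_pM2l ?mulr_gt0 ?exprn_gt0//.
  by have := sqr_sqrtr (ler0n R 2); have := sqrtr_ge0 (2 : R); nra.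
- exact/measurable_EFinP.
- by rewrite lee_fin mulr_ge0// exprn_ge0// ltW.
Qed.

(** The second moment is read off the Laplace transform of $X^2$ near 0: integrating $1-y\le
    e^{-y}\le1-y+y^2$ at $y=ux^2/2$ and expanding $(1+us^2)^{-1/2}$ gives an error of at most
    $32us^4$ for every $u>0$. *)
Lemma integral_X2_normal (s : R) : 0 < s ->
  (\int[normal_prob 0 s]_x (x ^+ 2)%:E = (s ^+ 2)%:E)%E.
Proof.
move=> s0.
have m4 := integral_X4_normal s0.
have mX k : measurable_fun [set: measurableTypeR R] (fun x : R => (x ^+ k)%:E).
  by apply/measurable_EFinP; exact: measurable_funX.
have ge0X2 (x : measurableTypeR R) : [set: measurableTypeR R] x -> (0 <= (x ^+ 2)%:E)%E.
  by move=> _; rewrite lee_fin sqr_ge0.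
have le14 (x : R) : x ^+ 2 <= 1 + x ^+ 4.
  by have := sqr_ge0 (x ^+ 2 - 1); have := sqr_ge0 (x ^+ 2); lra.
(* Finiteness comes from the fourth moment, so that the rest is arithmetic on reals. *)
have m2_fin : (\int[normal_prob 0 s]_x (x ^+ 2)%:E \is a fin_num)%E.
  rewrite ge0_fin_numE; last exact: integral_ge0.
  apply: (@le_lt_trans _ _ (\int[normal_prob 0 s]_x (1 + x ^+ 4)%:E)%E).
    apply: ge0_le_integral => //.
    - by apply/measurable_EFinP/measurable_funD => //; exact: measurable_funX.
    - by move=> x _; rewrite lee_fin; exact: le14.
  under eq_integral do rewrite EFinD.
  rewrite ge0_integralD//; last by move=> x _; rewrite lee_fin exprn_even_ge0.
  rewrite lte_add_pinfty//; last exact: le_lt_trans m4 (ltry _).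
  by rewrite integral_normal_prob1 ltry.
pose m2 := fine (\int[normal_prob 0 s]_x (x ^+ 2)%:E)%E.
have m2E : (\int[normal_prob 0 s]_x (x ^+ 2)%:E = m2%:E)%E by rewrite fineK.
have key u : 0 < u -> `|m2 - s ^+ 2| <= u * (32 * s ^+ 4).
  move=> u0.
  pose phi := (Num.sqrt (1 + u * s ^+ 2))^-1.
  have us0 : 0 < 1 + u * s ^+ 2 by rewrite addr_gt0// mulr_gt0// exprn_gt0.
  have phi0 : 0 < phi by rewrite invr_gt0 sqrtr_gt0.
  have phiE : phi ^+ 2 * (1 + u * s ^+ 2) = 1.
    by rewrite exprVn sqr_sqrtr ?ltW// mulVf// gt_eqF.
  have lap := integral_expR_sqr_normal s0 phi0 phiE.
  (* The quadratic term is kept next to the exponential, so every integrand is nonnegative and $1\le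
     f(x)\le1+u^2x^4/4$. *)
  pose f (x : R) := expR (- (u * x ^+ 2 / 2)) + u / 2 * x ^+ 2.
  have mE : measurable_fun [set: R] (fun x => expR (- (u * x ^+ 2 / 2))).
    apply: measurableT_comp => //; apply: measurableT_comp => //.
    by apply: measurable_funM => //; apply: measurable_funM => //;
      exact: measurable_funX.
  have mf : measurable_fun [set: R] f.
    by apply: measurable_funD => //; exact: measurable_funM.
  have fint : (\int[normal_prob 0 s]_x (f x)%:E = (phi + u / 2 * m2)%:E)%E.
    under eq_integral do rewrite EFinD EFinM.
    rewrite ge0_integralD//.
    - rewrite lap ge0_integralZl// ?m2E -?EFinM -?EFinD//.
      by rewrite lee_fin divr_ge0// ltW.
    - exact/measurable_EFinP.
    - by move=> x _; rewrite lee_fin mulr_ge0 ?sqr_ge0// divr_ge0// ltW.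
    - by apply/measurable_EFinP/measurable_funM => //; exact: measurable_funX.
  have lo : 1 <= phi + u / 2 * m2.
    rewrite -lee_fin -fint -(integral_normal_prob1 s); apply: ge0_le_integral => //.
    - exact/measurable_EFinP.
    - move=> x _; rewrite lee_fin /f; move: (x : R) => {}x.
      by have := expR_ge1Dx (- (u * x ^+ 2 / 2)); lra.
  have hi : phi + u / 2 * m2 <= 1 + u ^+ 2 / 4 * (64 * s ^+ 4).
    rewrite -lee_fin -fint.
    apply: (@le_trans _ _ (\int[normal_prob 0 s]_x (1 + u ^+ 2 / 4 * x ^+ 4)%:E)%E).
      apply: ge0_le_integral => //.
      - move=> x _; rewrite lee_fin addr_ge0 ?expR_ge0// mulr_ge0 ?sqr_ge0//.
        by rewrite divr_ge0// ltW.
      - exact/measurable_EFinP.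
      - apply/measurable_EFinP/measurable_funD => //; exact: measurable_funM.
      - move=> x _; rewrite lee_fin /f; move: (x : R) => {}x.
        have y0 : 0 <= u * x ^+ 2 / 2 by rewrite divr_ge0// mulr_ge0 ?sqr_ge0// ltW.
        by have := expRN_le_quadratic y0; lra.
    under eq_integral do rewrite EFinD EFinM.
    rewrite ge0_integralD//.
    - rewrite integral_normal_prob1 EFinD leeD2l//.
      rewrite ge0_integralZl//.
      + by rewrite [X in (_ <= X)%E]EFinM lee_pmul2l// ?lte_fin ?divr_gt0 ?exprn_gt0.
      + by move=> x _; rewrite lee_fin exprn_even_ge0.
      + by rewrite lee_fin divr_ge0// sqr_ge0.
    - move=> x _; rewrite lee_fin mulr_ge0 ?divr_ge0 ?sqr_ge0//.
      by rewrite exprn_even_ge0.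
    - by apply/measurable_EFinP/measurable_funM => //; exact: measurable_funX.
  have phi1 : phi <= 1.
    have : 0 <= u * s ^+ 2 by rewrite mulr_ge0 ?sqr_ge0// ltW.
    by move=> v0; rewrite leNgt; apply/negP => p1; move: phiE; nra.
  (* An opaque name for $us^2$, so that the nonlinear arithmetic sees only [w] and [phi]. The two
     bounds below are $\frac w2(1-w)\le1-(1+w)^{-1/2}\le\frac w2$. *)
  have [w wE] : exists w : R, w = u * s ^+ 2 by eexists.
  have w0 : 0 <= w by rewrite wE mulr_ge0 ?sqr_ge0// ltW.
  have {}phiE : w * phi ^+ 2 = (1 - phi) * (1 + phi).
    by move: phiE; rewrite -wE mulrDr mulr1; lra.
  have b1 : 1 - phi <= w / 2.
    have p1 : 0 < 1 + phi by rewrite addr_gt0.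
    by rewrite -(ler_pM2r p1) -phiE -mulrA ler_wpM2l//; nra.
  have b2 : w / 2 * (1 - w) <= 1 - phi.
    have [w1|w1] := lerP w 1; last by nra.
    have p1 : 0 < 1 + phi by rewrite addr_gt0.
    rewrite -(ler_pM2r p1) -phiE.
    have phi2 : phi ^+ 2 <= 1 by nra.
    have phi2' : 1 - w <= phi ^+ 2 by move: phiE; nra.
    apply: (@le_trans _ _ (w * (1 - w))); last exact: ler_wpM2l.
    have -> : w / 2 * (1 - w) * (1 + phi) = w * (1 - w) * ((1 + phi) / 2) by field.
    by rewrite ler_piMr ?mulr_ge0 ?subr_ge0//; lra.
  have s4 : w * s ^+ 2 = u * s ^+ 4 by rewrite wE; ring.
  have s4_ge0 : 0 <= u * s ^+ 4 by rewrite -s4 mulr_ge0 ?sqr_ge0.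
  have u_ge0 := ltW u0.
  rewrite ler_norml; apply/andP; split.
  - rewrite -(ler_pM2l u0).
    have : w * (1 - w) <= u * m2 by lra.
    have : u * (w * s ^+ 2) = w * w by rewrite wE; ring.
    rewrite s4 => e1 e2; move: (mulr_ge0 u_ge0 s4_ge0); rewrite wE in e1 e2 *; lra.
  - rewrite -(ler_pM2l u0) -[u * (m2 - _)]/(u * (m2 - _)).
    have : u * m2 <= w + 2 * (u ^+ 2 / 4 * (64 * s ^+ 4)) by lra.
    by rewrite wE; lra.
rewrite m2E; congr (_%:E); apply/eqP; rewrite -subr_eq0 -normr_le0.
apply/ler_addgt0Pr => e e0; rewrite add0r.
have s4 : 0 < 32 * s ^+ 4 by rewrite mulr_gt0// exprn_gt0.
by have := key _ (divr_gt0 e0 s4); rewrite divfK// gt_eqF.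
Qed.

Lemma integrable_normal_id (s : R) : 0 < s ->
  (normal_prob 0 s).-integrable setT (fun x => x%:E).
Proof.
move=> s0; apply/integrableP; split; first exact/measurable_EFinP.
apply: (@le_lt_trans _ _ (\int[normal_prob 0 s]_x (1 + x ^+ 2)%:E)%E).
  apply: ge0_le_integral => //.
  - by do 2! apply: measurableT_comp => //.
  - by apply/measurable_EFinP/measurable_funD => //; exact: measurable_funX.
  - move=> x _; rewrite abse_EFin lee_fin ler_norml; move: (x : R) => {}x.
    by apply/andP; split; have := sqr_ge0 (x - 1); have := sqr_ge0 (x + 1); lra.
under eq_integral do rewrite EFinD.
rewrite ge0_integralD//.
- by rewrite integral_X2_normal// integral_normal_prob1 -EFinD ltry.
- by move=> x _; rewrite lee_fin sqr_ge0.
- by apply/measurable_EFinP; exact: measurable_funX.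
Qed.

(* Jensen's inequality for the moment generating function, at both signs of a
   small argument, squeezes the mean. *)
Lemma integral_normal_id (s : R) : 0 < s ->
  (\int[normal_prob 0 s]_x x%:E = 0)%E.
Proof.
move=> s0; have int_id := integrable_normal_id s0.
have m1_fin := integrable_fin_num measurableT int_id.
pose m1 := fine (\int[normal_prob 0 s]_x x%:E)%E.
have m1E : (\int[normal_prob 0 s]_x x%:E = m1%:E)%E by rewrite fineK.
have mgf l : 1 + l * m1 <= expR (l ^+ 2 * s ^+ 2 / 2).
  rewrite -lee_fin -(integral_expR_normal_mgf l s0).
  have -> : ((1 + l * m1)%:E = \int[normal_prob 0 s]_x (1 + l * x)%:E)%E.
    under [RHS]eq_integral do rewrite EFinD EFinM.
    rewrite integralD//; last 2 first.
    - exact: finite_measure_integrable_cst.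
    - exact: integrableZl.
    rewrite integral_normal_prob1 integralZl//.
    by rewrite m1E -EFinM -EFinD.
  apply: le_integral => //.
  - rewrite (_ : (fun x => (1 + l * x)%:E) = (cst 1 \+ (fun x => l%:E * x%:E))%E).
      by apply: integrableD => //;
        [exact: finite_measure_integrable_cst|exact: integrableZl].
    by apply/funext => x /=; rewrite EFinD EFinM.
  - apply/integrableP; split.
      by apply/measurable_EFinP/measurableT_comp => //; exact: measurable_funM.
    under eq_integral do rewrite gee0_abs ?lee_fin ?expR_ge0//.
    by rewrite integral_expR_normal_mgf// ltry.
  - by move=> x _; rewrite lee_fin expR_ge1Dx.
have bound l : 0 < l -> l <= s^-1 -> `|m1| <= l * s ^+ 2.
  move=> l0 ls.
  have t1 : l ^+ 2 * s ^+ 2 <= 1.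
    rewrite -exprMn expr_le1 ?(mulr_ge0 (ltW l0) (ltW s0))//.
    by rewrite -ler_pdivlMr// div1r.
  have t0 : 0 < l ^+ 2 * s ^+ 2 by rewrite mulr_gt0 ?exprn_gt0.
  have exp_le : expR (l ^+ 2 * s ^+ 2 / 2) <= 1 + l ^+ 2 * s ^+ 2.
    rewrite -[X in expR X]opprK expRN.
    have := expR_ge1Dx (- (l ^+ 2 * s ^+ 2 / 2)).
    set t := l ^+ 2 * s ^+ 2 in t0 t1 *; set E := expR _ => E1.
    have E0 : 0 < E by lra.
    by rewrite -div1r ler_pdivrMr//; nra.
  have := mgf l; have := mgf (- l); rewrite sqrrN => m1l m1r.
  rewrite ler_norml; apply/andP; split; rewrite -(ler_pM2l l0).
    by move: (le_trans m1l exp_le); rewrite expr2; lra.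
  by move: (le_trans m1r exp_le); rewrite expr2; lra.
rewrite m1E; congr (_%:E); apply/eqP; rewrite -normr_le0.
apply/ler_addgt0Pr => e e0; rewrite add0r.
have s2 : 0 < s ^+ 2 by rewrite exprn_gt0.
apply: (@le_trans _ _ (Num.min s^-1 (e / s ^+ 2) * s ^+ 2)).
  by apply: bound; rewrite ?ge_min ?lexx// lt_min invr_gt0 s0 divr_gt0.
by rewrite -ler_pdivlMr// ge_min lexx orbT.
Qed.

End NormalMoments.

(** * Independent real random variables *)

Section Independence.
Context {d : measure_display} {Om : measurableType d} {R : realType}.
Variable P : probability Om R.

Definition indep_rv (X Y : Om -> R) : Prop :=
  forall C D : set R, measurable C -> measurable D ->
    (P (X @^-1` C `&` Y @^-1` D) = P (X @^-1` C) * P (Y @^-1` D))%E.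

(** Both measures agree on rectangles, which determine the product measure. *)
Lemma indep_rv_joint (X Y : {mfun Om >-> R}) (Z : {mfun Om >-> (R * R)%type}) :
  (forall w, Z w = (X w, Y w)) -> indep_rv X Y ->
  forall A, measurable A ->
    (distribution P X \x distribution P Y)%E A = distribution P Z A.
Proof.
move=> ZE XY; apply: product_measure_unique => A B mA mB.
rewrite /distribution /pushforward/= -XY//; congr (P _).
by apply/seteqP; split=> w /=; rewrite ZE.
Qed.

(** The integral is transported to the law of the pair, a product measure; Tonelli gives
    integrability of the product and Fubini its value. *)
Lemma indep_rv_integralM (X Y : Om -> R) :
  P.-integrable setT (EFin \o X) -> P.-integrable setT (EFin \o Y) ->
  indep_rv X Y ->
  P.-integrable setT (EFin \o (X \* Y)) /\
  (\int[P]_w (X w * Y w)%:E = \int[P]_w (X w)%:E * \int[P]_w (Y w)%:E)%E.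
Proof.
move=> iX iY XY.
have mX : measurable_fun setT X by apply/measurable_EFinP; exact: measurable_int iX.
have mY : measurable_fun setT Y by apply/measurable_EFinP; exact: measurable_int iY.
pose X' : {mfun Om >-> R} := mfun_Sub (mem_set mX).
pose Y' : {mfun Om >-> R} := mfun_Sub (mem_set mY).
have mZ : measurable_fun setT (fun w => (X w, Y w)) by exact/measurable_fun_pair.
pose Z' : {mfun Om >-> (R * R)%type} := mfun_Sub (mem_set mZ).
have joint := @indep_rv_joint X' Y' Z' (fun=> erefl) XY.
pose m1 := distribution P X'; pose m2 := distribution P Y'.
pose f (z : R * R) := (z.1 * z.2)%:E.
have mf : measurable_fun setT f.
  by apply/measurable_EFinP/measurable_funM; [exact: measurable_fst|exact: measurable_snd].
have eqZ (g : R * R -> \bar R) :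
    (\int[distribution P Z']_z g z = \int[(m1 \x m2)%E]_z g z)%E.
  by apply: eq_measure_integral => A mA _; exact/esym/joint.
have abs1 : (\int[m1]_x `|x%:E| = \int[P]_w `|(X w)%:E|)%E.
  by rewrite ge0_integral_distribution//; exact: measurableT_comp.
have abs2 : (\int[m2]_x `|x%:E| = \int[P]_w `|(Y w)%:E|)%E.
  by rewrite ge0_integral_distribution//; exact: measurableT_comp.
have [_ fX] := integrableP _ _ _ iX.
have [_ fY] := integrableP _ _ _ iY.
have int1 : m1.-integrable setT (fun x : R => x%:E).
  by apply/integrableP; split; [exact/measurable_EFinP|rewrite abs1].
have int2 : m2.-integrable setT (fun x : R => x%:E).
  by apply/integrableP; split; [exact/measurable_EFinP|rewrite abs2].
have fin2 : (\int[m2]_y `|y%:E| \is a fin_num)%E.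
  by rewrite ge0_fin_numE ?integral_ge0// abs2.
have fin1 : (\int[m1]_x `|x%:E| \is a fin_num)%E.
  by rewrite ge0_fin_numE ?integral_ge0// abs1.
have int12 : (m1 \x m2)%E.-integrable setT f.
  apply/integrable12ltyP => //.
  have inner (x : R) :
      (\int[m2]_y `|f (x, y)| = `|x%:E| * \int[m2]_y `|y%:E|)%E.
    rewrite -ge0_integralZl//; last exact: measurableT_comp.
    by apply: eq_integral => y _; rewrite -abseM.
  under eq_integral do rewrite inner.
  rewrite ge0_integralZr//; last 2 first.
  - exact: measurableT_comp.
  - exact: integral_ge0.
  by rewrite ltey_eq fin_numM.
have intP : P.-integrable setT (EFin \o (X \* Y)).
  apply/integrableP; split; first exact/measurable_EFinP/measurable_funM.
  have [_] := integrableP _ _ _ int12.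
  rewrite -(eqZ (abse \o f)).
  have -> : (\int[distribution P Z']_z (abse \o f) z
      = \int[P]_w ((abse \o f) \o Z') w)%E.
    apply: ge0_integral_distribution; first exact: measurableT_comp.
    by move=> y; exact: abse_ge0.
  by [].
split=> //.
rewrite -[LHS](@integral_distribution _ _ _ _ _ P Z' f)//.
rewrite eqZ -integral12_prod_meas1// /fubini_F/=.
have inner (x : R) : (\int[m2]_y f (x, y) = x%:E * \int[m2]_y y%:E)%E.
  by rewrite -integralZl.
under eq_integral do rewrite inner.
have fin2' : (\int[m2]_y y%:E \is a fin_num)%E by exact: integrable_fin_num.
rewrite -(fineK fin2') integralZr// fineK//.
by congr (_ * _)%E; exact: integral_distribution.
Qed.


(** The full event is put at every index other than [i] and [j]. *)
Lemma independent_pair n (G : 'I_n -> set (set Om)) : independent P G ->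
  (forall i, G i setT) ->
  forall i j A B, i != j -> G i A -> G j B -> (P (A `&` B) = P A * P B)%E.
Proof.
move=> indG GT i j A B ij GA GB.
pose F k := if k == i then A else if k == j then B else setT.
have FG k : G k (F k).
  by rewrite /F; have [->//|_] := eqVneq k i; have [->//|_] := eqVneq k j.
have FE : \bigcap_k F k = A `&` B.
  apply/seteqP; split=> w.
  - move=> Fw; split; first by have := Fw i I; rewrite /F eqxx.
    by have := Fw j I; rewrite /F eq_sym (negbTE ij) eqxx.
  - by move=> [Aw Bw] k _; rewrite /F; case: ifP => // _; case: ifP.
rewrite -FE indG// (bigD1 i)//= (bigD1 j)//= 1?eq_sym//.
rewrite [in X in (_ * (X * _))%E]/F eq_sym (negbTE ij) !eqxx.
rewrite {1}/F eqxx big1 ?mule1// => k /andP[ki kj].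
by rewrite /F (negbTE ki) (negbTE kj) probability_setT.
Qed.

Lemma indep_rv_comp (X Y : Om -> R) (f g : R -> R) :
  measurable_fun setT f -> measurable_fun setT g ->
  indep_rv X Y -> indep_rv (f \o X) (g \o Y).
Proof.
move=> mf mg XY C D mC mD.
apply: (XY (f @^-1` C) (g @^-1` D)); rewrite -[X in measurable X]setTI.
- exact: mf.
- exact: mg.
Qed.

End Independence.

Section SecondMoment.
Context {d : measure_display} {Om : measurableType d} {R : realType}.
Variable P : probability Om R.

(** After expanding the square the mixed terms integrate to 0, so the bound grows linearly in
    [n]. *)
Lemma integral_sqr_sum_uncorrelated n (Z : 'I_n -> Om -> R) (v : R) :
  (forall i j, P.-integrable setT (EFin \o (Z i \* Z j))) ->
  (forall i j, i != j -> \int[P]_w (Z i w * Z j w)%:E = 0)%E ->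
  (forall i, \int[P]_w (Z i w * Z i w)%:E <= v%:E)%E ->
  (\int[P]_w ((\sum_i Z i w) ^+ 2)%:E <= (n%:R * v)%:E)%E.
Proof.
move=> iZ uZ vZ.
have sqE w : (((\sum_i Z i w) ^+ 2)%:E
    = \sum_i \sum_j (Z i w * Z j w)%:E)%E.
  rewrite expr2 big_distrlr/= -sumEFin; apply: eq_bigr => i _.
  by rewrite -sumEFin.
under eq_integral do rewrite sqE.
rewrite integral_sum//; last first.
  by move=> i; apply: (integrable_sum measurableT) => j _; exact: iZ.
rewrite (_ : n%:R * v = \sum_(i < n) v); last by rewrite sumr_const card_ord mulr_natl.
rewrite -sumEFin.
apply: lee_sum => i _.
rewrite integral_sum//; last by move=> j; exact: iZ.
rewrite (bigD1 i)//= big1 ?adde0// => j ji.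
by rewrite uZ// eq_sym.
Qed.

Lemma chebyshev_sqr (S : Om -> R) (e v : R) : 0 < e -> measurable_fun setT S ->
  (\int[P]_w ((S w) ^+ 2)%:E <= v%:E)%E ->
  (P [set w | e <= `|S w|]%R <= (v / e ^+ 2)%:E)%E.
Proof.
move=> e0 mS vS; have e2 : 0 < e ^+ 2 by rewrite exprn_gt0.
rewrite EFinM lee_pdivlMr// muleC.
have mS2 : measurable_fun setT (fun w => ((S w) ^+ 2)%:E).
  by apply/measurable_EFinP; exact: measurable_funX.
have := @le_integral_abse _ _ _ P setT measurableT _ _ mS2 e2.
under eq_integral do rewrite gee0_abs ?lee_fin ?sqr_ge0//.
move=> /le_trans/(_ vS); congr (_ * P _ <= _)%E; rewrite setTI.
apply/seteqP; split=> w /=; rewrite lee_fin [`|S w ^+ 2|]ger0_norm ?sqr_ge0//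
    -(real_normK (num_real (S w))) ler_sqr// nnegrE; exact: ltW.
Qed.

End SecondMoment.

(** * Quadratic variation of Wiener processes *)

Lemma integral_cst_probability d (Om : measurableType d) (R : realType)
    (P : probability Om R) (c : R) : (\int[P]_w c%:E = c%:E)%E.
Proof.
rewrite integral_cst// -[RHS]mule1; congr (_ * _)%E.
exact: (@probability_setT _ _ _ P).
Qed.

Section NormalLaw.
Context {d : measure_display} {Om : measurableType d} {R : realType}.
Variables (P : probability Om R) (a : Om -> R) (s : R).
Hypothesis s_gt0 : 0 < s.
Hypothesis ma : measurable_fun setT a.
Hypothesis a_law : forall C : set R, measurable C ->
  P (a @^-1` C) = normal_prob 0 s C.

Let ma' : @measurable_fun _ _ Om (measurableTypeR R) setT a := ma.
Let a' : {mfun Om >-> measurableTypeR R} :=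
  @mfun_Sub _ _ Om (measurableTypeR R) a (mem_set ma').

Let distrE (f : measurableTypeR R -> \bar R) :
  (\int[distribution P a']_x f x = \int[normal_prob 0 s]_x f x)%E.
Proof. by apply: eq_measure_integral => A mA _; exact: a_law. Qed.

Lemma ge0_integral_normal_law (f : R -> R) :
  (forall x, 0 <= f x) -> measurable_fun setT f ->
  (\int[P]_w (f (a w))%:E = \int[normal_prob 0 s]_x (f x)%:E)%E.
Proof.
move=> f0 mf; rewrite -distrE ge0_integral_distribution//.
exact/measurable_EFinP.
Qed.

Lemma integrable_normal_law (f : R -> R) : measurable_fun setT f ->
  (normal_prob 0 s).-integrable setT (EFin \o f) ->
  P.-integrable setT (fun w => (f (a w))%:E).
Proof.
move=> mf /integrableP[_ fi]; apply/integrableP; split.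
  by apply/measurable_EFinP; exact: (measurableT_comp mf ma).
under eq_integral do rewrite abse_EFin.
rewrite (ge0_integral_normal_law (f := fun x => `|f x|))//.
exact: measurableT_comp.
Qed.

Lemma integrable_pow_normal_law : [/\ P.-integrable setT (fun w => (a w)%:E),
  P.-integrable setT (fun w => (a w ^+ 2)%:E) &
  P.-integrable setT (fun w => (a w ^+ 4)%:E)].
Proof.
split.
- by apply: (integrable_normal_law (f := id)) => //; exact: integrable_normal_id.
- apply: (integrable_normal_law (f := fun x => x ^+ 2)); first exact: measurable_funX.
  apply/integrableP; split; first by apply/measurable_EFinP; exact: measurable_funX.
  under eq_integral do rewrite /= ger0_norm ?sqr_ge0//.
  by rewrite integral_X2_normal// ltry.
- apply: (integrable_normal_law (f := fun x => x ^+ 4)); first exact: measurable_funX.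
  apply/integrableP; split; first by apply/measurable_EFinP; exact: measurable_funX.
  under eq_integral do rewrite /= ger0_norm ?exprn_even_ge0//.
  by rewrite (le_lt_trans (integral_X4_normal s_gt0))// ltry.
Qed.

Lemma integral_normal_law : (\int[P]_w (a w)%:E = 0)%E.
Proof.
rewrite -(integral_normal_id s_gt0) -(distrE EFin).
rewrite (@integral_distribution _ _ _ _ _ P a' EFin)//.
by case: integrable_pow_normal_law.
Qed.

Lemma integral_X2_normal_law : (\int[P]_w (a w ^+ 2)%:E = (s ^+ 2)%:E)%E.
Proof.
rewrite (ge0_integral_normal_law (f := fun x => x ^+ 2)) ?integral_X2_normal//.
by move=> x; exact: sqr_ge0.
Qed.

Lemma integral_X4_normal_law : (\int[P]_w (a w ^+ 4)%:E <= (64 * s ^+ 4)%:E)%E.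
Proof.
rewrite (ge0_integral_normal_law (f := fun x => x ^+ 4)) ?integral_X4_normal//.
by move=> x; exact: exprn_even_ge0.
Qed.

Lemma integrable_centered_sqr_normal_law :
  P.-integrable setT (fun w => (a w ^+ 2 - s ^+ 2)%:E).
Proof.
have [_ i2 _] := integrable_pow_normal_law.
rewrite (_ : (fun w => _) = (fun w => (a w ^+ 2)%:E) \- cst (s ^+ 2)%:E)%E.
  by apply: integrableB => //; exact: finite_measure_integrable_cst.
by apply/funext => w /=; rewrite EFinB.
Qed.

Lemma integral_centered_sqr_normal_law :
  (\int[P]_w (a w ^+ 2 - s ^+ 2)%:E = 0)%E.
Proof.
have [_ i2 _] := integrable_pow_normal_law.
under eq_integral do rewrite EFinB.
rewrite integralB//; last exact: finite_measure_integrable_cst.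
by rewrite integral_X2_normal_law integral_cst_probability subee.
Qed.

(** The cross term $-2a^2s^2$ is nonpositive, so the square is at most $a^4+s^4$, and $65=64+1$. *)
Lemma integral_centered_sqr2_normal_law :
  P.-integrable setT (fun w => ((a w ^+ 2 - s ^+ 2) ^+ 2)%:E) /\
  (\int[P]_w ((a w ^+ 2 - s ^+ 2) ^+ 2)%:E <= (65 * s ^+ 4)%:E)%E.
Proof.
have [_ _ i4] := integrable_pow_normal_law.
have le4 w : (a w ^+ 2 - s ^+ 2) ^+ 2 <= a w ^+ 4 + s ^+ 4.
  by have := mulr_ge0 (sqr_ge0 (a w)) (sqr_ge0 s); lra.
have mc : measurable_fun setT (fun w => ((a w ^+ 2 - s ^+ 2) ^+ 2)%:E).
  apply/measurable_EFinP/measurable_funX/measurable_funB => //.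
  exact: measurable_funX.
have isum : P.-integrable setT (fun w => (a w ^+ 4 + s ^+ 4)%:E).
  rewrite (_ : (fun w => _) = (fun w => (a w ^+ 4)%:E) \+ cst (s ^+ 4)%:E)%E.
    by apply: integrableD => //; exact: finite_measure_integrable_cst.
  by apply/funext => w /=; rewrite EFinD.
split.
  apply: (le_integrable measurableT mc _ isum) => w _.
  by rewrite !gee0_abs ?lee_fin ?le4 ?sqr_ge0// addr_ge0// exprn_even_ge0.
apply: (@le_trans _ _ (\int[P]_w (a w ^+ 4 + s ^+ 4)%:E)%E).
  apply: ge0_le_integral => //.
  - by move=> w _; rewrite lee_fin sqr_ge0.
  - exact: measurable_int isum.
  - by move=> w _; rewrite lee_fin.
under eq_integral do rewrite EFinD.
rewrite integralD//; last exact: finite_measure_integrable_cst.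
rewrite integral_cst_probability.
have -> : 65 * s ^+ 4 = 64 * s ^+ 4 + s ^+ 4 by ring.
by rewrite EFinD leeD2r//; exact: integral_X4_normal_law.
Qed.

End NormalLaw.

Section WienerIncrements.
Context {d : measure_display} {Om : measurableType d} {R : realType}.
Variable P : probability Om R.

Definition sigma_generated (W : R -> Om -> R) : set (set Om) :=
  <<s [set A | exists t (C : set R), [/\ 0 <= t, measurable C & A = W t @^-1` C]] >>.

Definition indep_sigma (G H : set (set Om)) : Prop :=
  forall A B, G A -> H B -> (P (A `&` B) = P A * P B)%E.

Lemma sigma_generated_sub r (W : R -> Om -> 'cV[R]_r) (J : set 'I_r) j :
  J j -> sigma_generated (fun t w => W t w j 0) `<=` sigma_process W J.
Proof.
move=> Jj; apply: sub_sigma_algebra2 => A [t [C [t0 mC ->]]].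
by exists t, j, C; split.
Qed.

(** A product of two increments is measurable for the $\sigma$-algebra of its own process, so
    independence of two processes passes to the variables $a_ia_j$ and $b_ib_j$ of the covariation
    bound. *)
Lemma sigma_generated_increments (W : R -> Om -> R) (t1 t2 t3 t4 : R) (C : set R) :
  0 <= t1 -> 0 <= t2 -> 0 <= t3 -> 0 <= t4 -> measurable C ->
  sigma_generated W ((fun w => (W t1 w - W t2 w) * (W t3 w - W t4 w)) @^-1` C).
Proof.
move=> t10 t20 t30 t40 mC.
pose G := [set A | exists t (C : set R), [/\ 0 <= t, measurable C & A = W t @^-1` C]].
have mW t : 0 <= t -> measurable_fun [set: g_sigma_algebraType G]
    (W t : g_sigma_algebraType G -> R).
  move=> t0 _ Y mY; rewrite setTI; apply: sub_gen_smallest.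
  by exists t, Y; split.
have mU : measurable_fun [set: g_sigma_algebraType G] (fun w : g_sigma_algebraType G =>
    (W t1 w - W t2 w) * (W t3 w - W t4 w)).
  by apply: measurable_funM; apply: measurable_funB; exact: mW.
by have := mU measurableT _ mC; rewrite setTI.
Qed.

Section OneProcess.
Variables (W : R -> Om -> R) (T : R) (n : nat).
Hypothesis W_wiener : standard_wiener1 P W.
Hypotheses (T_gt0 : 0 < T) (n_gt0 : (0 < n)%N).

Let a i w := increment T n (W ^~ w) i.
Let h := T / n%:R.

Let h_gt0 : 0 < h. Proof. by rewrite divr_gt0// ltr0n. Qed.

Let grid_ge0 i : 0 <= grid T n i.
Proof. by rewrite mulr_ge0// ltW. Qed.

Let s_gt0 : 0 < Num.sqrt h. Proof. by rewrite sqrtr_gt0. Qed.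

Let grid_lt i : grid T n i < grid T n i.+1.
Proof. by rewrite -subr_gt0 gridS. Qed.

Lemma measurable_increment i : measurable_fun setT (a i).
Proof. by have [mW _ _ _ _] := W_wiener; apply: measurable_funB; exact: mW. Qed.

Lemma increment_law i (C : set R) : measurable C ->
  P (a i @^-1` C) = normal_prob 0 (Num.sqrt h) C.
Proof.
move=> mC; have [_ _ _ law _] := W_wiener.
by rewrite /h -(gridS T n i) -law//; exact: grid_lt.
Qed.

Lemma indep_increment (i j : 'I_n) : i != j -> indep_rv P (a i) (a j).
Proof.
move=> ij C D mC mD; have [_ _ _ _ ind] := W_wiener.
have {}ind := ind n (grid T n) (grid_ge0 0) (fun i => ltW (grid_lt i)).
apply: (independent_pair ind _ ij).
- by move=> k; exists setT => //; rewrite preimage_setT setTI.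
- by exists C => //; rewrite setTI.
- by exists D => //; rewrite setTI.
Qed.

Lemma integral_increment2 (i j : 'I_n) :
  P.-integrable setT (EFin \o (a i \* a j)) /\
  (\int[P]_w (a i w * a j w)%:E = (h *+ (i == j))%:E)%E.
Proof.
have mom k :=
  integrable_pow_normal_law s_gt0 (measurable_increment k) (increment_law k).
have [<-|ij] := eqVneq i j.
  have [_ i2 _] := mom i.
  split; first by rewrite (_ : _ \o _ = fun w => (a i w ^+ 2)%:E).
  have := integral_X2_normal_law s_gt0 (measurable_increment i) (increment_law i).
  by rewrite sqr_sqrtr ?ltW// mulr1n.
have [i1 _ _] := mom i; have [j1 _ _] := mom j.
have [intM ->] := indep_rv_integralM i1 j1 (indep_increment ij).
split=> //.
rewrite (integral_normal_law s_gt0 (measurable_increment i) (increment_law i)).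
by rewrite mul0e mulr0n.
Qed.

(** As $nh=T$, the deviation is the sum of the $T^{-1}(a_i^2-h)$, which are centered and
    uncorrelated by independence of the increments. *)
Lemma quadratic_variation_chebyshev (e : R) : 0 < e ->
  (P [set w | e <= `|T^-1 * \sum_(i < n) (a i w * a i w) - 1|]%R
    <= (65 / e ^+ 2 / n%:R)%:E)%E.
Proof.
move=> e0.
pose Z (i : 'I_n) w := T^-1 * (a i w ^+ 2 - h).
have n0 : n%:R != 0 :> R by rewrite pnatr_eq0 -lt0n.
have T0 : T != 0 by rewrite gt_eqF.
have e20 : e != 0 by rewrite gt_eqF.
have SE w : T^-1 * \sum_(i < n) (a i w * a i w) - 1 = \sum_i Z i w.
  rewrite -mulr_sumr sumrB mulrBr; congr (_ - _).
  rewrite sumr_const card_ord -mulr_natr /h; field; by rewrite T0 n0.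
under eq_set do rewrite SE.
(* Each of the [n] summands has variance at most $65h^2/T^2=65/n^2$. *)
have -> : 65 / e ^+ 2 / n%:R = n%:R * (65 / n%:R ^+ 2) / e ^+ 2.
  by field; rewrite e20 n0.
have mZ i : measurable_fun setT (Z i).
  apply: measurable_funM => //; apply: measurable_funB => //.
  by apply: measurable_funX; exact: measurable_increment.
apply: chebyshev_sqr => //; first exact: measurable_sum.
have hE : h = Num.sqrt h ^+ 2 by rewrite sqr_sqrtr// ltW.
have cI i := integrable_centered_sqr_normal_law s_gt0 (measurable_increment i)
  (increment_law i).
have cE i := integral_centered_sqr_normal_law s_gt0 (measurable_increment i)
  (increment_law i).
have cS i := integral_centered_sqr2_normal_law s_gt0 (measurable_increment i)
  (increment_law i).
have ind (i j : 'I_n) : i != j ->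
    indep_rv P (fun w => a i w ^+ 2 - h) (fun w => a j w ^+ 2 - h).
  move=> ij; apply: (indep_rv_comp (f := fun x => x ^+ 2 - h) (g := fun x => x ^+ 2 - h) _ _
    (indep_increment ij)).
    by apply: measurable_funB => //; exact: measurable_funX.
  by apply: measurable_funB => //; exact: measurable_funX.
rewrite -hE in cI cE cS.
have ZZ (i j : 'I_n) w : Z i w * Z j w
    = T^-1 ^+ 2 * ((a i w ^+ 2 - h) * (a j w ^+ 2 - h)) by rewrite /Z; ring.
have prod_int (i j : 'I_n) : P.-integrable setT
    (fun w => ((a i w ^+ 2 - h) * (a j w ^+ 2 - h))%:E).
  have [<-|ij] := eqVneq i j; first exact: (cS i).1.
  by have [] := indep_rv_integralM (cI i) (cI j) (ind _ _ ij).
apply: integral_sqr_sum_uncorrelated.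
- move=> i j; rewrite (_ : _ \o _ =
    fun w => ((T^-1 ^+ 2)%:E * ((a i w ^+ 2 - h) * (a j w ^+ 2 - h))%:E)%E).
    exact: integrableZl.
  by apply/funext => w /=; rewrite ZZ EFinM.
- move=> i j ij; under eq_integral do rewrite ZZ EFinM.
  rewrite integralZl//.
  have [_ ->] := indep_rv_integralM (cI i) (cI j) (ind _ _ ij).
  by rewrite cE mul0e mule0.
- move=> i; under eq_integral do rewrite ZZ EFinM.
  rewrite integralZl//.
  have -> : 65 / n%:R ^+ 2 = T^-1 ^+ 2 * (65 * h ^+ 2).
    by rewrite /h; field; rewrite T0 n0.
  rewrite [X in (_ <= X)%E]EFinM lee_pmul2l// ?lte_fin ?exprn_gt0 ?invr_gt0//.
  have -> : 65 * h ^+ 2 = 65 * Num.sqrt h ^+ 4 by rewrite {1}hE; ring.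
  exact: (cS i).2.
Qed.

End OneProcess.

(** The product $Z_iZ_j$ is regrouped as $T^{-2}(a_ia_j)(b_ib_j)$, one factor per process, so its
    mean factors: it is 0 for $i\ne j$ and $h^2/T^2=1/n^2$ for $i=j$. *)
Lemma covariation_chebyshev (W W' : R -> Om -> R) (T e : R) (n : nat) :
  standard_wiener1 P W -> standard_wiener1 P W' ->
  indep_sigma (sigma_generated W) (sigma_generated W') ->
  0 < T -> (0 < n)%N -> 0 < e ->
  (P [set w | e <= `|T^-1 * \sum_(i < n) (increment T n (W ^~ w) i
                                       * increment T n (W' ^~ w) i)|]%R
    <= (e ^- 2 / n%:R)%:E)%E.
Proof.
move=> wW wW' indW T_gt0 n_gt0 e0.
pose a i w := increment T n (W ^~ w) i.
pose b i w := increment T n (W' ^~ w) i.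
pose h := T / n%:R.
pose Z (i : 'I_n) w := T^-1 * (a i w * b i w).
have n0 : n%:R != 0 :> R by rewrite pnatr_eq0 -lt0n.
have T0 : T != 0 by rewrite gt_eqF.
have e20 : e != 0 by rewrite gt_eqF.
have grid_ge0 i : 0 <= grid T n i by rewrite mulr_ge0// ltW// divr_gt0// ltr0n.
under eq_set do rewrite mulr_sumr.
have -> : e ^- 2 / n%:R = n%:R * (n%:R ^- 2) / e ^+ 2.
  by field; rewrite e20 n0.
have ma i := measurable_increment wW T_gt0 n_gt0 i.
have mb i := measurable_increment wW' T_gt0 n_gt0 i.
have mZ i : measurable_fun setT (Z i).
  apply: measurable_funM; first exact: measurable_cst.
  by apply: measurable_funM; [exact: ma|exact: mb].
apply: chebyshev_sqr => //; first exact: measurable_sum.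
have AB (i j : 'I_n) : indep_rv P (a i \* a j) (b i \* b j).
  by move=> C D mC mD; apply: indW; exact: sigma_generated_increments.
have ABint (i j : 'I_n) :
    P.-integrable setT (fun w => ((a i w * a j w) * (b i w * b j w))%:E) /\
    (\int[P]_w ((a i w * a j w) * (b i w * b j w))%:E
     = ((h *+ (i == j)) * (h *+ (i == j)))%:E)%E.
  have [ia ea] := integral_increment2 wW T_gt0 n_gt0 i j.
  have [ib eb] := integral_increment2 wW' T_gt0 n_gt0 i j.
  have [iab eab] := indep_rv_integralM ia ib (AB i j).
  by split=> //; rewrite eab ea eb -EFinM.
have ZZ (i j : 'I_n) w : Z i w * Z j w
    = T^-1 ^+ 2 * ((a i w * a j w) * (b i w * b j w)) by rewrite /Z; ring.
apply: integral_sqr_sum_uncorrelated.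
- move=> i j; rewrite (_ : _ \o _ =
    fun w => ((T^-1 ^+ 2)%:E * ((a i w * a j w) * (b i w * b j w))%:E)%E).
    by apply: integrableZl => //; exact: (ABint i j).1.
  by apply/funext => w /=; rewrite ZZ EFinM.
- move=> i j ij; under eq_integral do rewrite ZZ EFinM.
  rewrite integralZl//; last exact: (ABint i j).1.
  by rewrite (ABint i j).2 (negbTE ij) mulr0n mul0r mule0.
- move=> i; under eq_integral do rewrite ZZ EFinM.
  rewrite integralZl//; last exact: (ABint i i).1.
  rewrite (ABint i i).2 eqxx mulr1n -EFinM lee_fin.
  by rewrite le_eqVlt; apply/orP; left; apply/eqP; rewrite /h; field; rewrite T0 n0.
Qed.

End WienerIncrements.

(** * Convergence in probability *)

Lemma cvg_natV (R : realType) : (n%:R^-1 : R) @[n --> \oo] --> 0.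
Proof.
by rewrite -(cvg_shiftS (fun n => n%:R^-1 : R)); exact: cvg_harmonic.
Qed.

Section ConvergenceInProbability.
Context {d : measure_display} {Om : measurableType d} {R : realType}.
Variable P : probability Om R.

Definition cvg_prob (Z : nat -> Om -> R) (z : R) : Prop :=
  forall e, 0 < e -> P [set w | e <= `|Z n w - z|] @[n --> \oo] --> 0%E.

Lemma measurable_set_dist (Z : Om -> R) (z e : R) :
  measurable_fun setT Z -> measurable [set w | e <= `|Z w - z|].
Proof.
move=> mZ.
have mb : measurable_fun setT (fun w => e <= `|Z w - z|).
  apply: measurable_fun_ler; first exact: measurable_cst.
  by apply: measurableT_comp => //; apply: measurable_funB.
have := mb measurableT [set true] I; rewrite setTI; congr measurable.
Qed.

Lemma cvg_prob_of_bound (Z : nat -> Om -> R) (z : R) :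
  (forall e, 0 < e -> exists K : R, forall n, (0 < n)%N ->
    (P [set w | e <= `|Z n w - z|]%R <= (K / n%:R)%:E)%E) -> cvg_prob Z z.
Proof.
move=> bound e e0; have [K KP] := bound e e0.
apply: (@squeeze_cvge _ _ _ _ (cst 0%E) _ (fun n => (K / n%:R)%:E)).
- near=> n; rewrite measure_ge0/=; apply: KP; near: n; exact: nbhs_infty_gt.
- exact: cvg_cst.
- rewrite (_ : 0%E = (K * 0)%:E); last by rewrite mulr0.
  apply: cvg_EFin; first exact: nearW.
  apply: cvgM; first exact: cvg_cst.
  exact: cvg_natV.
Unshelve. all: by end_near. Qed.

Lemma cvg_probD (Z Z' : nat -> Om -> R) (z z' : R) :
  (forall n, measurable_fun setT (Z n)) -> (forall n, measurable_fun setT (Z' n)) ->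
  cvg_prob Z z -> cvg_prob Z' z' -> cvg_prob (fun n w => Z n w + Z' n w) (z + z').
Proof.
move=> mZ mZ' cZ cZ' e e0.
have e2 : 0 < e / 2 by rewrite divr_gt0.
have m1 n := measurable_set_dist z (e / 2) (mZ n).
have m2 n := measurable_set_dist z' (e / 2) (mZ' n).
apply: (@squeeze_cvge _ _ _ _ (cst 0%E) _
  (fun n => P [set w | e / 2 <= `|Z n w - z|]%R
    + P [set w | e / 2 <= `|Z' n w - z'|]%R)%E).
- near=> n; rewrite measure_ge0/=; apply: le_trans (measureU2 _ (m1 n) (m2 n)).
  apply: le_measure; rewrite ?inE.
  + by apply: measurable_set_dist; exact: measurable_funD.
  + exact: measurableU.
  move=> w /= ew; have [?|lt1] := lerP (e / 2) `|Z n w - z|; first by left.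
  right; rewrite leNgt; apply/negP => lt2.
  move: ew; rewrite leNgt => /negP; apply.
  rewrite opprD addrACA (le_lt_trans (ler_normD _ _))//.
  lra.
- exact: cvg_cst.
- by rewrite -[X in _ --> X]adde0; apply: cvgeD => //; [exact: cZ|exact: cZ'].
Unshelve. all: by end_near. Qed.

Lemma cvg_prob_cst (z : R) : cvg_prob (fun=> cst z) z.
Proof.
move=> e e0; rewrite (_ : (fun n => _) = cst 0%E); first exact: cvg_cst.
apply/funext => n; rewrite (_ : [set w | _] = set0) ?measure0//.
by apply/seteqP; split=> w //=; rewrite subrr normr0 leNgt e0.
Qed.

Lemma cvg_probZ (c : R) (Z : nat -> Om -> R) (z : R) :
  cvg_prob Z z -> cvg_prob (fun n w => c * Z n w) (c * z).
Proof.
move=> cZ; have [->|c0] := eqVneq c 0.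
  rewrite mul0r (_ : (fun n w => _) = fun=> cst 0); first exact: cvg_prob_cst.
  by apply/funext => n; apply/funext => w; rewrite mul0r.
move=> e e0; have c0' : 0 < `|c| by rewrite normr_gt0.
rewrite (_ : (fun n => _) = (fun n => P [set w | e / `|c| <= `|Z n w - z|])).
  exact: cZ (divr_gt0 e0 c0').
apply/funext => n; congr (P _); apply/seteqP; split=> w /=;
  by rewrite -mulrBr normrM ler_pdivrMr// mulrC.
Qed.

Lemma cvg_prob_sum (I : Type) (r : seq I) (Z : I -> nat -> Om -> R) (z : I -> R) :
  (forall i n, measurable_fun setT (Z i n)) -> (forall i, cvg_prob (Z i) (z i)) ->
  cvg_prob (fun n w => \sum_(i <- r) Z i n w) (\sum_(i <- r) z i).
Proof.
move=> mZ cZ; elim: r => [|i r IHr].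
  rewrite big_nil (_ : (fun n w => _) = fun=> cst 0); first exact: cvg_prob_cst.
  by apply/funext => n; apply/funext => w; rewrite big_nil.
rewrite big_cons (_ : (fun n w => _) = fun n w => Z i n w + \sum_(i <- r) Z i n w).
  by apply: cvg_probD => // n; exact: measurable_sum.
by apply/funext => n; apply/funext => w; rewrite big_cons.
Qed.

(** Dominated convergence for the indicators of the deviation events, which are eventually 0 at
    almost every outcome. *)
Lemma cvg_prob_ae (Z : nat -> Om -> R) (z : R) :
  (forall n, measurable_fun setT (Z n)) ->
  {ae P, forall w, Z n w @[n --> \oo] --> z} -> cvg_prob Z z.
Proof.
move=> mZ aeZ e e0.
pose A n := [set w | e <= `|Z n w - z|].
have mA n : measurable (A n) by exact: measurable_set_dist.
have := @dominated_convergence _ _ _ P setT measurableT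
  (fun n w => (\1_(A n) w)%:E) (cst 0%E) (cst 1%E).
case.
- by move=> n; apply/measurable_EFinP; exact: measurable_indic.
- exact: measurable_cst.
- apply: filterS aeZ => w cZw _.
  apply: (@cvg_trans _ (cst 0%E @ \oo)); last exact: cvg_cst.
  apply: near_eq_cvg; move/cvgrPdist_lt : cZw => /(_ _ e0); apply: filterS => n.
  rewrite distrC => lt_e; rewrite /= indicE memNset//= /A/=.
  by apply/negP; rewrite -ltNge.
- exact: finite_measure_integrable_cst.
- by apply: aeW => w n _; rewrite gee0_abs ?lee_fin// indicE; case: (_ \in _).
move=> _ _; rewrite integral0; apply: cvg_trans.
rewrite (_ : (fun n => P _) = (fun n => \int[P]_x (\1_(A n) x)%:E)%E)//.
by apply/funext => n; rewrite integral_indic// setIT.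
Qed.

End ConvergenceInProbability.

Section WienerRealizedCovariance.
Context {d : measure_display} {Om : measurableType d} {R : realType}.
Variable P : probability Om R.

(** Independence is recorded pairwise between coordinates: this is what the covariation bound
    consumes, and it is stable under stacking mutually independent vectors. *)
Definition wiener_noise r (W : R -> Om -> 'cV[R]_r) : Prop :=
  (forall j, standard_wiener1 P (fun t w => W t w j 0)) /\
  (forall j k, j != k -> indep_sigma P (sigma_generated (fun t w => W t w j 0))
                                     (sigma_generated (fun t w => W t w k 0))).

Lemma standard_wiener_noise r (W : R -> Om -> 'cV[R]_r) :
  standard_wiener P W -> wiener_noise W.
Proof.
move=> [wW indW]; split=> // j k jk A B sA sB.
apply: (independent_pair indW _ jk).
- by move=> i; exact: (@measurableT _ (g_sigma_algebraType _)).
- exact: sigma_generated_sub sA.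
- exact: sigma_generated_sub sB.
Qed.

Lemma wiener_noise_col_mx r1 r2 (U : R -> Om -> 'cV[R]_r1) (V : R -> Om -> 'cV[R]_r2) :
  wiener_noise U -> wiener_noise V ->
  (forall j k, indep_sigma P (sigma_generated (fun t w => U t w j 0))
                             (sigma_generated (fun t w => V t w k 0))) ->
  wiener_noise (fun t w => col_mx (U t w) (V t w)).
Proof.
move=> [wU iU] [wV iV] iUV.
have up j : (fun t w => col_mx (U t w) (V t w) (lshift r2 j) 0) = fun t w => U t w j 0.
  by apply/funext => t; apply/funext => w; rewrite col_mxEu.
have dn j : (fun t w => col_mx (U t w) (V t w) (rshift r1 j) 0) = fun t w => V t w j 0.
  by apply/funext => t; apply/funext => w; rewrite col_mxEd.
split=> [j|j k].
  by case: (split_ordP j) => i ->; rewrite ?up ?dn.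
case: (split_ordP j) => a ->; case: (split_ordP k) => b ->; rewrite ?up ?dn.
- by rewrite (inj_eq (@lshift_inj _ _)); exact: iU.
- by move=> _; exact: iUV.
- by move=> _ A B sA sB; rewrite setIC muleC; exact: (iUV b a).
- by rewrite (inj_eq (@rshift_inj _ _)); exact: iV.
Qed.

Section Limit.
Variables (T : R) (r : nat) (W : R -> Om -> 'cV[R]_r).
Hypotheses (T_gt0 : 0 < T) (W_noise : wiener_noise W).

Lemma random_matrix_wiener_noise t : 0 <= t -> random_matrix (W t).
Proof. by move=> t0 i j; rewrite ord1; have [mW _ _ _ _] := W_noise.1 i; exact: mW. Qed.

Let mQ n : random_matrix (realized_cov T W n).
Proof.
apply: random_matrix_realized_cov (ltW T_gt0) _ => t /andP[t0 _].
exact: random_matrix_wiener_noise.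
Qed.

Lemma cvg_prob_realized_cov_wiener j k :
  cvg_prob P (fun n w => realized_cov T W n w j k) (1%:M j k).
Proof.
pose y i t w := W t w i 0.
have QE i1 i2 n w : realized_cov T W n w i1 i2 = T^-1 * \sum_(i < n)
    (increment T n (y i1 ^~ w) i * increment T n (y i2 ^~ w) i).
  rewrite realized_covE mxE summxE; congr (_ * _); apply: eq_bigr => i _.
  by rewrite mxE big_ord1 !mxE.
apply: cvg_prob_of_bound => e e0; rewrite mxE.
have [<-|jk] := eqVneq j k.
- exists (65 / e ^+ 2) => n n0; under eq_set do rewrite QE mulr1n.
  exact: quadratic_variation_chebyshev (W_noise.1 j) T_gt0 n0 _ e0.
- exists (e ^- 2) => n n0; under eq_set do rewrite QE mulr0n subr0.
  exact: covariation_chebyshev (W_noise.1 j) (W_noise.1 k) (W_noise.2 _ _ jk) T_gt0 n0 e0.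
Qed.

(** An entry of $KQK^\top$ is a fixed linear combination of entries of $Q$, so stability under sums
    and scalar multiples suffices. *)
Lemma cvg_prob_realized_cov_mulmx p (K : 'M[R]_(p, r)) a b :
  cvg_prob P (fun n w => realized_cov T (fun t w => K *m W t w) n w a b)
    ((K *m K^T) a b).
Proof.
have entryE (Q : 'M[R]_r) : (K *m Q *m K^T) a b
    = \sum_k K b k * (\sum_j K a j * Q j k).
  rewrite mxE; apply: eq_bigr => k _; rewrite mulrC; congr (_ * _).
    by rewrite mxE.
  by rewrite mxE.
have -> : (K *m K^T) a b = (K *m 1%:M *m K^T) a b by rewrite mulmx1.
rewrite entryE.
rewrite (_ : (fun n w => _) = fun n w =>
    \sum_k K b k * (\sum_j K a j * realized_cov T W n w j k)); last first.
  by apply/funext => n; apply/funext => w; rewrite realized_cov_mulmx entryE.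
have mS k n : measurable_fun setT (fun w => \sum_j K a j * realized_cov T W n w j k).
  apply: measurable_sum => j; apply: measurable_funM; first exact: measurable_cst.
  exact: mQ.
apply: cvg_prob_sum => [k n|k].
  by apply: measurable_funM; [exact: measurable_cst|exact: mS].
apply: cvg_probZ; apply: cvg_prob_sum => [j n|j].
  by apply: measurable_funM; [exact: measurable_cst|exact: mQ].
by apply: cvg_probZ; exact: cvg_prob_realized_cov_wiener.
Qed.

End Limit.

End WienerRealizedCovariance.

(** * Effect of a Lipschitz perturbation of the path *)

Section PathwisePerturbation.
Context {R : realType}.

(** Heine's theorem in near-covering form: the property that [dl] works at [s] holds near each point
    of the segment for small [dl], and compactness makes it hold for all [s] at once. *)
Lemma uniform_continuity_itv (T : R) (f : R -> R) : {within `[0, T], continuous f} ->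
  forall e, 0 < e -> exists2 dl : R, 0 < dl & forall s t, 0 <= s <= T -> 0 <= t <= T ->
    `|s - t| < dl -> `|f s - f t| < e.
Proof.
move=> cf e e0.
have /compact_near_coveringP/(_ R (0^'+)) := @segment_compact R 0 T.
move=> /(_ (fun dl s => forall t, 0 <= s <= T -> 0 <= t <= T -> `|s - t| < dl ->
  `|f s - f t| < e) _) cov.
have e2 : 0 < e / 2 by rewrite divr_gt0.
have {cov} : \forall dl \near 0^'+, forall s, `[0, T]%classic s -> forall t,
    0 <= s <= T -> 0 <= t <= T -> `|s - t| < dl -> `|f s - f t| < e.
  apply: cov => x xT.
  have := (subspace_continuousP _ _).1 cf x xT.
  move=> /cvgrPdist_lt/(_ _ e2); rewrite /within/= => /nbhs_ballP[eta /= eta0 fx].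
  have eta2 : 0 < eta / 2 by rewrite divr_gt0.
  exists (ball x (eta / 2), [set dl : R | dl < eta / 2]).
    by split; [exact: nbhsx_ballx|exact: nbhs_right_lt].
  move=> [s dl] [/= xs dl_lt] t sT tT st.
  have xs2 : `|x - s| < eta / 2 by [].
  have fs : `|f x - f s| < e / 2.
    apply: fx; last by rewrite /= in_itv.
    by apply: lt_le_trans xs2 _; lra.
  have ft : `|f x - f t| < e / 2.
    apply: fx; last by rewrite /= in_itv.
    rewrite /ball/= -(subrKA s) (le_lt_trans (ler_normD _ _))//; lra.
  rewrite -(subrKA (f x)) (le_lt_trans (ler_normD _ _))// [`|f s - _|]distrC; lra.
move=> unif; near (0 : R)^'+ => dl; exists dl; first by near: dl; exact: nbhs_right_gt.
move=> s t sT tT st.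
by have := near unif dl; apply=> //=.
Unshelve. all: by end_near. Qed.

Definition lipschitz_path (T : R) p (x : R -> 'cV[R]_p) : Prop :=
  exists2 C : R, 0 <= C & forall s t, 0 <= s <= T -> 0 <= t <= T ->
    forall i, `|x t i 0 - x s i 0| <= C * `|t - s|.

(** Write $dx\,dx'-dy\,dy'=D\,dy'+dy\,D'+D\,D'$ with $|D|,|D'|\le Ch$. For a fine grid the
    increments of [y] are at most [e'], so the [n] terms with $nh=T$ contribute at most
    $2Ce'+C^2T/n$. The unit type serves as a one-point space of outcomes. *)
Lemma realized_cov_perturbation (T : R) p (x y : R -> 'cV[R]_p) : 0 < T ->
  lipschitz_path T (fun t => x t - y t) ->
  (forall i, {within `[0, T], continuous (fun t => y t i 0)}) ->
  forall a b, realized_cov T (fun t _ => x t) n tt a b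
    - realized_cov T (fun t _ => y t) n tt a b @[n --> \oo] --> 0.
Proof.
move=> T0 [C C0 lipC] cy a b.
apply/cvgrPdist_lt => e e0.
(* Chosen so that $2Ce'\le e/2$; the added 1 allows $C=0$. *)
pose e' := e / 2 / (2 * C + 1).
have C1 : 0 < 2 * C + 1 by rewrite ltr_wpDl ?mulr_ge0.
have e'0 : 0 < e' by rewrite !divr_gt0.
have [da da0 unifa] := uniform_continuity_itv (cy a) e'0.
have [db db0 unifb] := uniform_continuity_itv (cy b) e'0.
have cvh (c : R) : c / n%:R @[n --> \oo] --> 0.
  by rewrite -[X in _ --> X](mulr0 c); apply: cvgM; [exact: cvg_cst|exact: cvg_natV].
have near_lt (c e1 : R) : 0 < e1 -> \forall n \near \oo, c / n%:R < e1.
  by move=> e10; apply: cvgr_lt e10; exact: cvh.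
near=> n.
have n0 : (0 < n)%N by near: n; exact: nbhs_infty_gt.
have n0' : n%:R != 0 :> R by rewrite pnatr_eq0 -lt0n.
pose h := T / n%:R.
have h0 : 0 < h by rewrite divr_gt0// ltr0n.
have ha : T / n%:R < da by near: n; exact: near_lt.
have hb : T / n%:R < db by near: n; exact: near_lt.
have Ch : C ^+ 2 * T / n%:R < e / 2.
  by near: n; apply: near_lt; rewrite divr_gt0.
pose dx i := increment T n x i; pose dy i := increment T n y i.
have gin (i : 'I_n) : 0 <= grid T n i <= T /\ 0 <= grid T n i.+1 <= T.
  by split; apply: grid_in; rewrite ?(ltW T0) ?(ltnW (ltn_ord i)) ?ltn_ord.
have gh (i : 'I_n) : `|grid T n i.+1 - grid T n i| = h by rewrite gridS gtr0_norm.
have D (i : 'I_n) c : `|dx i c 0 - dy i c 0| <= C * h.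
  have [g1 g2] := gin i; have := lipC _ _ g1 g2 c; rewrite gh; apply: le_trans.
  by rewrite /dx /dy /increment !mxE; rewrite le_eqVlt; apply/orP; left;
    apply/eqP; congr `|_|; ring.
have ya (i : 'I_n) : `|dy i a 0| <= e'.
  have [g1 g2] := gin i; rewrite /dy /increment !mxE ltW// unifa// gh.
  exact: ha.
have yb (i : 'I_n) : `|dy i b 0| <= e'.
  have [g1 g2] := gin i; rewrite /dy /increment !mxE ltW// unifb// gh.
  exact: hb.
rewrite sub0r normrN !realized_covE.
have -> : (T^-1 *: \sum_(i < n) (dx i *m (dx i)^T)) a b
    - (T^-1 *: \sum_(i < n) (dy i *m (dy i)^T)) a b
  = T^-1 * \sum_(i < n) (dx i a 0 * dx i b 0 - dy i a 0 * dy i b 0).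
  rewrite !mxE -mulrBr !summxE -sumrB; congr (_ * _); apply: eq_bigr => i _.
  by rewrite !mxE !big_ord1 !mxE.
have bnd (i : 'I_n) : `|dx i a 0 * dx i b 0 - dy i a 0 * dy i b 0|
    <= 2 * e' * (C * h) + (C * h) ^+ 2.
  have Ch0 : 0 <= C * h by rewrite mulr_ge0// ltW.
  have -> : dx i a 0 * dx i b 0 - dy i a 0 * dy i b 0
    = (dx i a 0 - dy i a 0) * dy i b 0 + dy i a 0 * (dx i b 0 - dy i b 0)
      + (dx i a 0 - dy i a 0) * (dx i b 0 - dy i b 0) by ring.
  apply: le_trans (ler_normD _ _) _; rewrite normrM expr2 lerD//; last first.
    by rewrite ler_pM.
  apply: le_trans (ler_normD _ _) _; rewrite !normrM.
  have -> : 2 * e' * (C * h) = (C * h) * e' + e' * (C * h) by ring.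
  by rewrite lerD// ler_pM.
rewrite normrM (ger0_norm (ltW _)) ?invr_gt0//.
apply: (@le_lt_trans _ _ (T^-1 * \sum_(i < n) (2 * e' * (C * h) + (C * h) ^+ 2))).
  rewrite ler_pM2l ?invr_gt0//; apply: le_trans (ler_norm_sum _ _ _) _.
  by apply: ler_sum => i _.
have sumE c : \sum_(i < n) c = n%:R * c by rewrite sumr_const card_ord mulr_natl.
rewrite sumE.
have -> : T^-1 * (n%:R * (2 * e' * (C * h) + (C * h) ^+ 2))
   = e' * (2 * C) + C ^+ 2 * T / n%:R.
  by rewrite /h; field; rewrite n0' gt_eqF.
have : e' * (2 * C) <= e / 2.
  rewrite -[leRHS](divfK (lt0r_neq0 C1)).
  by rewrite ler_wpM2l ?ltW//; lra.
lra.
Unshelve. all: by end_near. Qed.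

End PathwisePerturbation.

(** * The realized covariance of the model *)

Section LipschitzPath.
Context {R : realType}.
Local Notation mu := (@lebesgue_measure R).

Lemma lipschitz_pathD (T : R) p (x y : R -> 'cV[R]_p) :
  lipschitz_path T x -> lipschitz_path T y -> lipschitz_path T (fun t => x t + y t).
Proof.
move=> [C C0 Cx] [D D0 Dy]; exists (C + D); first exact: addr_ge0.
move=> s t sT tT i; rewrite !mxE opprD addrACA mulrDl.
by rewrite (le_trans (ler_normD _ _))// lerD ?Cx ?Dy.
Qed.

Lemma lipschitz_path_mulmx (T : R) p r (K : 'M[R]_(p, r)) (x : R -> 'cV[R]_r) :
  lipschitz_path T x -> lipschitz_path T (fun t => K *m x t).
Proof.
move=> [C C0 Cx]; exists ((\sum_i \sum_j `|K i j|) * C).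
  by rewrite mulr_ge0// sumr_ge0// => i _; rewrite sumr_ge0.
move=> s t sT tT i; rewrite !mxE -sumrB.
apply: (@le_trans _ _ (\sum_j `|K i j| * (C * `|t - s|))).
  apply: le_trans (ler_norm_sum _ _ _) _; apply: ler_sum => j _.
  by rewrite -mulrBr normrM ler_wpM2l// Cx.
rewrite -mulr_suml -mulrA ler_wpM2r ?mulr_ge0//.
rewrite [leRHS](bigD1 i)//= lerDl sumr_ge0// => k _.
by rewrite sumr_ge0.
Qed.

(** A bound of the continuous integrand on the compact interval is a Lipschitz constant. *)
Lemma Rintegral_lipschitz (T : R) (g : R -> R) : {within `[0, T], continuous g} ->
  exists2 C : R, 0 <= C & forall s t, 0 <= s <= T -> 0 <= t <= T ->
    `|\int[mu]_(u in `[0, t]) g u - \int[mu]_(u in `[0, s]) g u| <= C * `|t - s|.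
Proof.
move=> cg.
have /compact_bounded[M [_ /(_ (`|M| + 1))]] :=
  continuous_compact cg (@segment_compact R 0 T).
have M1 : M < `|M| + 1 by rewrite (le_lt_trans (ler_norm _))// ltrDl.
move=> /(_ M1) gM; exists (`|M| + 1); first by rewrite addr_ge0.
have gb u : 0 <= u <= T -> `|g u| <= `|M| + 1.
  by move=> uT; apply: gM; exists u => //=; rewrite in_itv.
have intg : mu.-integrable `[0, T] (EFin \o g).
  exact: continuous_compact_integrable (@segment_compact R 0 T) cg.
move=> s t; wlog st : s t / s <= t.
  move=> wl sT tT; have /orP[st|ts] := le_total s t; first exact: wl.
  by rewrite distrC [`|t - s|]distrC; exact: wl.
move=> /andP[s0 sT] /andP[t0 tT].
have int0t : mu.-integrable `[0, t] (EFin \o g).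
  by apply: integrableS intg => //; apply: subset_itvl; rewrite bnd_simp.
rewrite Rintegral_itvB//.
have intst : mu.-integrable `]s, t] (EFin \o g).
  by apply: integrableS int0t => //; apply: subset_itvr; rewrite bnd_simp.
apply: le_trans (le_normr_Rintegral _ intst) _ => //.
apply: (@le_trans _ _ (\int[mu]_(u in `]s, t]) (`|M| + 1))).
  apply: le_Rintegral => //.
  - exact: integrable_norm.
  - apply: (@integrableS _ _ _ mu `[0, T]) => //.
      by move=> u /=; rewrite !in_itv/= => /andP[su ut];
        rewrite (le_trans s0 (ltW su)) (le_trans ut tT).
    apply: continuous_compact_integrable; first exact: segment_compact.
    by apply: continuous_subspaceT => u; exact: cvg_cst.
  - move=> u /=; rewrite in_itv/= => /andP[su ut]; apply: gb.
    by rewrite (le_trans s0 (ltW su)) (le_trans ut tT).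
rewrite Rintegral_cst//= lebesgue_measure_itv/= lte_fin.
have [->|st'] := eqVneq s t; first by rewrite ltxx subrr normr0.
by rewrite lt_neqAle st' st/= [`|t - s|]ger0_norm ?subr_ge0.
Qed.


End LipschitzPath.

Section RealizedCovarianceLimit.
Context {d : measure_display} {Om : measurableType d} {R : realType}.
Variable P : probability Om R.

(** With additive noise, $Y-SW$ is $c$ plus the time integral of the drift along a continuous path.
    The Lipschitz constant depends on the path. *)
Lemma sde_lipschitz_path (T : R) k r (B : 'cV[R]_k -> 'cV[R]_k) (S : 'M[R]_(k, r))
    (c : 'cV[R]_k) (W : R -> Om -> 'cV[R]_r) (Y : R -> Om -> 'cV[R]_k) :
  sde_solution P T B S c W Y -> regular_drift B ->
  {ae P, forall w, lipschitz_path T (fun t => Y t w - S *m W t w)}.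
Proof.
move=> [_ aeY] [_ Breg]; apply: filterS aeY => w [cY eqY].
have cB i : {within `[0, T], continuous (fun s => B (Y s w) i 0)}.
  (* The empty list of derivatives gives continuity of the drift itself. *)
  have [cBi _ _] := Breg i [::] isT.
  apply/subspace_continuousP => s sT.
  apply: (@cvg_comp _ _ _ (fun s => Y s w) (fun x => B x i 0) _ (nbhs (Y s w))).
    exact: ((subspace_continuousP _ _).1 cY s sT).
  exact: cBi.
have lipB i : exists C : R, 0 <= C /\ forall s t, 0 <= s <= T -> 0 <= t <= T ->
    `|\int[lebesgue_measure]_(u in `[0, t]) B (Y u w) i 0
      - \int[lebesgue_measure]_(u in `[0, s]) B (Y u w) i 0| <= C * `|t - s|.
  by have [C C0 CB] := Rintegral_lipschitz (cB i); exists C.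
have [C CP] := choice lipB.
exists (\sum_i C i); first by apply: sumr_ge0 => i _; exact: (CP i).1.
move=> s t sT tT i; rewrite !mxE eqY// eqY// !mxE.
apply: (@le_trans _ _ (C i * `|t - s|)).
  apply: le_trans ((CP i).2 s t sT tT); rewrite le_eqVlt; apply/orP; left.
  by apply/eqP; congr `|_|; ring.
rewrite ler_wpM2r// (bigD1 i)//= lerDl; apply: sumr_ge0 => j _; exact: (CP j).1.
Qed.

Lemma wiener_noise_continuous (T : R) r (W : R -> Om -> 'cV[R]_r) :
  wiener_noise P W ->
  {ae P, forall w, forall j, {within `[0, T], continuous (fun t => W t w j 0)}}.
Proof.
move=> [wW _]; apply: filter_forall => j; have [_ _ cW _ _] := wW j.
apply: filterS cW => w; apply: continuous_subspaceW => t /=.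
by rewrite !in_itv/= => /andP[->].
Qed.

(** The realized covariance of [X] is that of $KW$ plus a difference which tends to 0 on almost
    every path, hence in probability. *)
Lemma cvg_prob_realized_cov (T : R) p r (K : 'M[R]_(p, r))
    (W : R -> Om -> 'cV[R]_r) (X : R -> Om -> 'cV[R]_p) :
  0 < T -> wiener_noise P W -> (forall t, 0 <= t <= T -> random_matrix (X t)) ->
  {ae P, forall w, lipschitz_path T (fun t => X t w - K *m W t w)} ->
  forall a b, cvg_prob P (fun n w => realized_cov T X n w a b) ((K *m K^T) a b).
Proof.
move=> T0 nW mX lipX a b.
have mKW t : 0 <= t <= T -> random_matrix (fun w => K *m W t w).
  move=> /andP[t0 _]; apply: random_matrixM; first exact: random_matrix_cst.
  exact: random_matrix_wiener_noise nW _ t0.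
have mQX n := @random_matrix_realized_cov _ _ _ _ _ _ n (ltW T0) mX a b.
have mQW n := @random_matrix_realized_cov _ _ _ _ _ _ n (ltW T0) mKW a b.
rewrite -[X in cvg_prob _ _ X]add0r (_ : (fun n w => _) = (fun n w =>
    (realized_cov T X n w a b - realized_cov T (fun t w => K *m W t w) n w a b)
    + realized_cov T (fun t w => K *m W t w) n w a b)); last first.
  by apply/funext => n; apply/funext => w; rewrite subrK.
apply: cvg_probD => [n|//||]; first exact: measurable_funB.
  apply: cvg_prob_ae => [n|]; first exact: measurable_funB.
  apply: filterS2 lipX (wiener_noise_continuous T nW) => w lipw cW.
  apply: (@realized_cov_perturbation _ T _ (X ^~ w) (fun t => K *m W t w)) => // i.
  rewrite (_ : (fun t => _) = (fun t => \sum_j K i j * W t w j 0)); last first.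
    by apply/funext => t; rewrite mxE.
  move=> t; apply: cvg_sumr => j; apply: cvgM; first exact: cvg_cst.
  exact: cW.
exact: cvg_prob_realized_cov_mulmx.
Qed.

End RealizedCovarianceLimit.

Section SemRealizedCovariance.
Context {d : measure_display} {Om : measurableType d} {R : realType}.
Variable P : probability Om R.

Lemma sigma_generated_col_mx r1 r2 (U : R -> Om -> 'cV[R]_r1) (V : R -> Om -> 'cV[R]_r2)
    (G : set (set Om)) :
  (forall j, indep_sigma P G (sigma_generated (fun t w => U t w j 0))) ->
  (forall j, indep_sigma P G (sigma_generated (fun t w => V t w j 0))) ->
  forall j, indep_sigma P G (sigma_generated (fun t w => col_mx (U t w) (V t w) j 0)).
Proof.
move=> iU iV j; case: (split_ordP j) => i ->.
- rewrite (_ : (fun t w => _) = (fun t w => U t w i 0)); first exact: iU.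
  by apply/funext => t; apply/funext => w; rewrite col_mxEu.
- rewrite (_ : (fun t w => _) = (fun t w => V t w i 0)); first exact: iV.
  by apply/funext => t; apply/funext => w; rewrite col_mxEd.
Qed.

(** Joint independence of the four $\sigma$-algebras is unfolded into the six pairs, which give the
    cross conditions at each level of stacking. *)
Lemma wiener_noise4 r1 r2 r3 r4
    (W1 : R -> Om -> 'cV[R]_r1) (W2 : R -> Om -> 'cV[R]_r2)
    (W3 : R -> Om -> 'cV[R]_r3) (W4 : R -> Om -> 'cV[R]_r4) :
  standard_wiener P W1 -> standard_wiener P W2 ->
  standard_wiener P W3 -> standard_wiener P W4 ->
  independent P (fun i : 'I_4 =>
     nth set0 [:: sigma_process W1 setT; sigma_process W2 setT;
                  sigma_process W3 setT; sigma_process W4 setT] i) ->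
  wiener_noise P (fun t w =>
    col_mx (W1 t w) (col_mx (W2 t w) (col_mx (W3 t w) (W4 t w)))).
Proof.
move=> w1 w2 w3 w4 indW.
have sT r (W : R -> Om -> 'cV[R]_r) : sigma_process W setT setT.
  exact: (@measurableT _ (g_sigma_algebraType _)).
have pair := independent_pair indW.
have {}pair : forall i j : 'I_4, i != j -> indep_sigma P
    (nth set0 [:: sigma_process W1 setT; sigma_process W2 setT;
                  sigma_process W3 setT; sigma_process W4 setT] i)
    (nth set0 [:: sigma_process W1 setT; sigma_process W2 setT;
                  sigma_process W3 setT; sigma_process W4 setT] j).
  move=> i j ij A B; apply: pair ij.
  by case=> -[|[|[|[|//]]]] lt4; exact: sT.
have sub r (W : R -> Om -> 'cV[R]_r) j A :
    sigma_generated (fun t w => W t w j 0) A -> sigma_process W setT A.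
  exact: sigma_generated_sub.
have i12 : indep_sigma P (sigma_process W1 setT) (sigma_process W2 setT).
  exact: (pair (@Ordinal 4 0 isT) (@Ordinal 4 1 isT) isT).
have i13 : indep_sigma P (sigma_process W1 setT) (sigma_process W3 setT).
  exact: (pair (@Ordinal 4 0 isT) (@Ordinal 4 2 isT) isT).
have i14 : indep_sigma P (sigma_process W1 setT) (sigma_process W4 setT).
  exact: (pair (@Ordinal 4 0 isT) (@Ordinal 4 3 isT) isT).
have i23 : indep_sigma P (sigma_process W2 setT) (sigma_process W3 setT).
  exact: (pair (@Ordinal 4 1 isT) (@Ordinal 4 2 isT) isT).
have i24 : indep_sigma P (sigma_process W2 setT) (sigma_process W4 setT).
  exact: (pair (@Ordinal 4 1 isT) (@Ordinal 4 3 isT) isT).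
have i34 : indep_sigma P (sigma_process W3 setT) (sigma_process W4 setT).
  exact: (pair (@Ordinal 4 2 isT) (@Ordinal 4 3 isT) isT).
have cross r r' (W : R -> Om -> 'cV[R]_r) (W' : R -> Om -> 'cV[R]_r') :
    indep_sigma P (sigma_process W setT) (sigma_process W' setT) ->
    forall j k, indep_sigma P (sigma_generated (fun t w => W t w j 0))
                              (sigma_generated (fun t w => W' t w k 0)).
  by move=> iW j k A B sA sB; apply: iW; [exact: sub sA|exact: sub sB].
apply: wiener_noise_col_mx; first exact: standard_wiener_noise.
  apply: wiener_noise_col_mx; first exact: standard_wiener_noise.
    by apply: wiener_noise_col_mx; [exact: standard_wiener_noise..|exact: cross].
  by move=> j; apply: sigma_generated_col_mx => k; exact: cross.
move=> j; apply: sigma_generated_col_mx => k; first exact: cross.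
by move: k; apply: sigma_generated_col_mx => k; exact: cross.
Qed.

(** The matrix $K$ through which the stacked noise enters the observed process, one block of columns
    per Wiener process. Separate blocks leave no cross terms in $KK^\top$. *)
Definition noise_loading p1 p2 k1 k2 r1 r2 r3 r4 (m : sem R p1 p2 k1 k2)
    (S1 : 'M[R]_(k1, r1)) (S2 : 'M[R]_(p1, r2)) (S3 : 'M[R]_(p2, r3))
    (S4 : 'M[R]_(k2, r4)) : 'M[R]_(p1 + p2, r1 + (r2 + (r3 + r4))) :=
  row_mx (xi_loading m *m S1) (row_mx (col_mx S2 0) (row_mx (col_mx 0 S3)
    (zeta_loading m *m S4))).

Lemma noise_loading_gram p1 p2 k1 k2 r1 r2 r3 r4
    (L1 : 'M[R]_(p1, k1)) (L2 : 'M[R]_(p2, k2)) (G : 'M[R]_(k2, k1)) (B : 'M[R]_k2)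
    (S1 : 'M[R]_(k1, r1)) (S2 : 'M[R]_(p1, r2)) (S3 : 'M[R]_(p2, r3))
    (S4 : 'M[R]_(k2, r4)) :
  let m := true_sem L1 L2 G B S1 S2 S3 S4 in
  noise_loading m S1 S2 S3 S4 *m (noise_loading m S1 S2 S3 S4)^T = sem_Sigma m.
Proof.
move=> m; rewrite sem_SigmaE; last by rewrite /= trmx_mul trmxK.
rewrite /noise_loading !tr_row_mx !mul_row_col.
rewrite !trmx_mul !tr_col_mx !mul_col_row !trmx0 !(mulmx0, mul0mx) /= !mulmxA.
rewrite -[RHS]addrA; congr (_ + _).
by rewrite addrA add_block_mx !addr0 !add0r addrC.
Qed.

Lemma lipschitz_path_eq (T : R) p (x y : R -> 'cV[R]_p) :
  (forall t, 0 <= t <= T -> x t = y t) -> lipschitz_path T x -> lipschitz_path T y.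
Proof.
by move=> xy [C C0 Cx]; exists C => // s t sT tT i; rewrite -!xy//; exact: Cx.
Qed.

(** Eliminating [eta] makes the observed process a constant linear image of the four latent ones;
    each of these is its noise term plus a Lipschitz path, so the general limit applies with
    [noise_loading]. *)
Lemma sem_realized_cov (p1 p2 k1 k2 r1 r2 r3 r4 : nat) (T : R)
  (W1 : R -> Om -> 'cV[R]_r1) (W2 : R -> Om -> 'cV[R]_r2)
  (W3 : R -> Om -> 'cV[R]_r3) (W4 : R -> Om -> 'cV[R]_r4)
  (B1 : 'cV[R]_k1 -> 'cV[R]_k1) (B2 : 'cV[R]_p1 -> 'cV[R]_p1)
  (B3 : 'cV[R]_p2 -> 'cV[R]_p2) (B4 : 'cV[R]_k2 -> 'cV[R]_k2)
  (S1 : 'M[R]_(k1, r1)) (S2 : 'M[R]_(p1, r2))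
  (S3 : 'M[R]_(p2, r3)) (S4 : 'M[R]_(k2, r4))
  (c1 : 'cV[R]_k1) (c2 : 'cV[R]_p1) (c3 : 'cV[R]_p2) (c4 : 'cV[R]_k2)
  (xi : R -> Om -> 'cV[R]_k1) (del : R -> Om -> 'cV[R]_p1)
  (eps : R -> Om -> 'cV[R]_p2) (zeta : R -> Om -> 'cV[R]_k2)
  (L1 : 'M[R]_(p1, k1)) (L2 : 'M[R]_(p2, k2))
  (G : 'M[R]_(k2, k1)) (B : 'M[R]_k2)
  (eta : R -> Om -> 'cV[R]_k2) (X : R -> Om -> 'cV[R]_(p1 + p2)) :
  0 < T ->
  standard_wiener P W1 -> standard_wiener P W2 ->
  standard_wiener P W3 -> standard_wiener P W4 ->
  independent P (fun i : 'I_4 =>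
     nth set0 [:: sigma_process W1 setT; sigma_process W2 setT;
                  sigma_process W3 setT; sigma_process W4 setT] i) ->
  sde_solution P T B1 S1 c1 W1 xi -> sde_solution P T B2 S2 c2 W2 del ->
  sde_solution P T B3 S3 c3 W3 eps -> sde_solution P T B4 S4 c4 W4 zeta ->
  regular_drift B1 -> regular_drift B2 -> regular_drift B3 -> regular_drift B4 ->
  1%:M - B \in unitmx ->
  (forall t w, 0 <= t <= T -> eta t w = B *m eta t w + G *m xi t w + zeta t w) ->
  (forall t w, 0 <= t <= T ->
     X t w = col_mx (L1 *m xi t w + del t w) (L2 *m eta t w + eps t w)) ->
  (forall t, 0 <= t <= T -> random_matrix (X t)) /\
  forall a b, cvg_prob P (fun n w => realized_cov T X n w a b)
    (sem_Sigma (true_sem L1 L2 G B S1 S2 S3 S4) a b).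
Proof.
move=> T0 w1 w2 w3 w4 indW xi_sde del_sde eps_sde zeta_sde r_1 r_2 r_3 r_4 uPsi etaE XE.
pose m := true_sem L1 L2 G B S1 S2 S3 S4.
have {}XE t w : 0 <= t <= T -> X t w = xi_loading m *m xi t w
    + (col_mx 1%:M 0 *m del t w + (col_mx 0 1%:M *m eps t w
    + zeta_loading m *m zeta t w)).
  move=> tT; rewrite XE// /xi_loading /zeta_loading !mul_col_mx !mul1mx !mul0mx.
  rewrite !add_col_mx !(add0r, addr0) -!mulmxA; congr col_mx.
  (* The structural equation solved for [eta], from $\Psi\eta=\Gamma\xi+\zeta$. *)
  have -> : eta t w = invmx (1%:M - B) *m (G *m xi t w + zeta t w).
    rewrite -[LHS](mulKmx uPsi) mulmxBl mul1mx {1}etaE//; congr (_ *m _).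
    by rewrite [LHS]addrC !addrA addNr add0r.
  by rewrite !mulmxDr addrAC addrA.
have rm := @random_matrix_cst _ Om R.
have mX t : 0 <= t <= T -> random_matrix (X t).
  move=> tT; rewrite (_ : X t = fun w => xi_loading m *m xi t w
      + (col_mx 1%:M 0 *m del t w + (col_mx 0 1%:M *m eps t w
      + zeta_loading m *m zeta t w))); last by apply/funext => w; exact: XE.
  apply: random_matrixD.
    by apply: random_matrixM; [exact: rm|exact: xi_sde.1].
  apply: random_matrixD.
    by apply: random_matrixM; [exact: rm|exact: del_sde.1].
  apply: random_matrixD.
    by apply: random_matrixM; [exact: rm|exact: eps_sde.1].
  by apply: random_matrixM; [exact: rm|exact: zeta_sde.1].
split=> // a b; rewrite -/m -noise_loading_gram.
apply: cvg_prob_realized_cov => //.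
  exact: wiener_noise4 w1 w2 w3 w4 indW.
have l1 := sde_lipschitz_path xi_sde r_1.
have l2 := sde_lipschitz_path del_sde r_2.
have l3 := sde_lipschitz_path eps_sde r_3.
have l4 := sde_lipschitz_path zeta_sde r_4.
have l34 : {ae P, forall w, lipschitz_path T (fun t => eps t w - S3 *m W3 t w) /\
    lipschitz_path T (fun t => zeta t w - S4 *m W4 t w)}.
  by apply: filterS2 l3 l4.
apply: filterS3 l1 l2 l34 => w x1 x2 [x3 x4].
have := lipschitz_pathD (lipschitz_path_mulmx (xi_loading m) x1)
  (lipschitz_pathD (lipschitz_path_mulmx (col_mx 1%:M 0) x2)
  (lipschitz_pathD (lipschitz_path_mulmx (col_mx 0 1%:M) x3)
                   (lipschitz_path_mulmx (zeta_loading m) x4))).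
apply: lipschitz_path_eq => t tT.
rewrite XE// /noise_loading !mul_row_col !mulmxBr !mulmxA !mul_col_mx !mul1mx !mul0mx.
have addrBB (V : zmodType) (u v u' v' : V) : u + v - (u' + v') = u - u' + (v - v').
  by rewrite opprD addrACA.
by rewrite !addrBB.
Qed.


End SemRealizedCovariance.

(** * Events of probability tending to one and consistency of the test *)

Section HighProbability.
Context {d : measure_display} {Om : measurableType d} {R : realType}.
Variable P : probability Om R.

Lemma cvg_prob_norm (Z : nat -> Om -> R) (z : R) :
  cvg_prob P Z z -> cvg_prob P (fun n w => `|Z n w - z|) 0.
Proof.
move=> cZ e e0; rewrite (_ : (fun n => _) = (fun n => P [set w | e <= `|Z n w - z|])).
  exact: cZ.
by apply/funext => n; congr (P _); apply/seteqP; split=> w /=; rewrite subr0 normr_id.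
Qed.

(** The probability is squeezed between 1 minus that of the deviation event and 1. Asking for the
    inclusion only for large [n] leaves room for a sample size threshold. *)
Lemma cvg_prob_event (Z : nat -> Om -> R) (z e : R) (E : nat -> set Om) :
  0 < e -> (forall n, measurable_fun setT (Z n)) -> cvg_prob P Z z ->
  (\forall n \near \oo, measurable (E n) /\ forall w, `|Z n w - z| < e -> E n w) ->
  P (E n) @[n --> \oo] --> 1%E.
Proof.
move=> e0 mZ cZ nearE.
pose B n := [set w | e <= `|Z n w - z|].
have mB n : measurable (B n) by exact: measurable_set_dist.
apply: (@squeeze_cvge _ _ _ _ (fun n => 1 - P (B n))%E _ (cst 1%E)).
- apply: filterS nearE => n [mE BE]; rewrite probability_le1// andbT.
  rewrite -probability_setC//; apply: le_measure; rewrite ?inE//.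
    exact: measurableC.
  by move=> w /= nB; apply: BE; rewrite ltNge; apply/negP.
- rewrite -[X in _ --> X]sube0; apply: cvgeB => //; first exact: cvg_cst.
  exact: cZ.
- exact: cvg_cst.
Qed.

End HighProbability.

Theorem theorem10
  (R : realType) (d : measure_display) (Om : measurableType d)
  (P : probability Om R)
  (* dimensions *)
  (p1 p2 k1 k2 r1 r2 r3 r4 q : nat)
  (p1_gt0 : (0 < p1)%N) (p2_gt0 : (0 < p2)%N)
  (k1_gt0 : (0 < k1)%N) (k2_gt0 : (0 < k2)%N)
  (r1_gt0 : (0 < r1)%N) (r2_gt0 : (0 < r2)%N)
  (r3_gt0 : (0 < r3)%N) (r4_gt0 : (0 < r4)%N)
  (k1_le : (k1 <= p1)%N) (k2_le : (k2 <= p2)%N)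
  (T alpha : R) (T_gt0 : 0 < T) (alpha01 : 0 < alpha < 1)
  (* driving noise *)
  (W1 : R -> Om -> 'cV[R]_r1) (W2 : R -> Om -> 'cV[R]_r2)
  (W3 : R -> Om -> 'cV[R]_r3) (W4 : R -> Om -> 'cV[R]_r4)
  (W1_wiener : standard_wiener P W1) (W2_wiener : standard_wiener P W2)
  (W3_wiener : standard_wiener P W3) (W4_wiener : standard_wiener P W4)
  (W_indep : independent P (fun i : 'I_4 =>
     nth set0 [:: sigma_process W1 setT; sigma_process W2 setT;
                  sigma_process W3 setT; sigma_process W4 setT] i))
  (* latent processes *)
  (B1 : 'cV[R]_k1 -> 'cV[R]_k1) (B2 : 'cV[R]_p1 -> 'cV[R]_p1)
  (B3 : 'cV[R]_p2 -> 'cV[R]_p2) (B4 : 'cV[R]_k2 -> 'cV[R]_k2)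
  (S1 : 'M[R]_(k1, r1)) (S2 : 'M[R]_(p1, r2))
  (S3 : 'M[R]_(p2, r3)) (S4 : 'M[R]_(k2, r4))
  (c1 : 'cV[R]_k1) (c2 : 'cV[R]_p1) (c3 : 'cV[R]_p2) (c4 : 'cV[R]_k2)
  (xi : R -> Om -> 'cV[R]_k1) (del : R -> Om -> 'cV[R]_p1)
  (eps : R -> Om -> 'cV[R]_p2) (zeta : R -> Om -> 'cV[R]_k2)
  (xi_sde : sde_solution P T B1 S1 c1 W1 xi)
  (del_sde : sde_solution P T B2 S2 c2 W2 del)
  (eps_sde : sde_solution P T B3 S3 c3 W3 eps)
  (zeta_sde : sde_solution P T B4 S4 c4 W4 zeta)
  (B1_reg : regular_drift B1) (B2_reg : regular_drift B2)
  (B3_reg : regular_drift B3) (B4_reg : regular_drift B4)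
  (xi_moments : bounded_moments P T xi)
  (del_moments : bounded_moments P T del)
  (eps_moments : bounded_moments P T eps)
  (zeta_moments : bounded_moments P T zeta)
  (Sdd0_posdef : posdef (S2 *m S2^T)) (See0_posdef : posdef (S3 *m S3^T))
  (* true coefficient matrices and observed process *)
  (Lx10 : 'M[R]_(p1, k1)) (Lx20 : 'M[R]_(p2, k2))
  (Gam0 : 'M[R]_(k2, k1)) (B0 : 'M[R]_k2)
  (Lx10_rank : \rank Lx10 = k1)
  (B0_diag : forall i, B0 i i = 0)
  (Psi0_unit : 1%:M - B0 \in unitmx)
  (eta : R -> Om -> 'cV[R]_k2) (X : R -> Om -> 'cV[R]_(p1 + p2))
  (eta_eq : forall t w, 0 <= t <= T ->
     eta t w = B0 *m eta t w + Gam0 *m xi t w + zeta t w)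
  (X_eq : forall t w, 0 <= t <= T ->
     X t w = col_mx (Lx10 *m xi t w + del t w) (Lx20 *m eta t w + eps t w))
  (* parametric model *)
  (Theta : set 'rV[R]_q)
  (Theta_convex : convex_set (Theta : set (convex_lmodType 'rV[R]_q)))
  (Theta_compact : compact Theta)
  (model : @pattern R q p1 p2 k1 k2)
  (model_wp : well_parametrized model)
  (model_adm : forall theta, Theta theta -> admissible (sem_at model theta))
  (* contrast estimator *)
  (theta_hat : nat -> Om -> 'rV[R]_q)
  (theta_hat_rv : forall n, (0 < n)%N -> random_matrix (theta_hat n))
  (theta_hat_in : forall n w, (0 < n)%N -> Theta (theta_hat n w))
  (theta_hat_inf : forall n w, (0 < n)%N ->
     let Fn theta := empirical_contrast (realized_cov T X n w)
                       (sem_Sigma (sem_at model theta)) in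
     Fn (theta_hat n w) = inf (Fn @` Theta))
  (* penalized estimator *)
  (lambda1 lambda2 : nat -> R) (gamma delta : R)
  (lambda1_gt0 : forall n, (0 < n)%N -> 0 < lambda1 n)
  (lambda2_gt0 : forall n, (0 < n)%N -> 0 < lambda2 n)
  (gamma_gt0 : 0 < gamma) (delta_gt0 : 0 < delta)
  (theta_tilde : nat -> Om -> 'rV[R]_q)
  (theta_tilde_rv : forall n, (0 < n)%N -> random_matrix (theta_tilde n))
  (theta_tilde_min : forall n w, (0 < n)%N ->
     let kappa := \row_j adaptive_weight (lambda1 n) (lambda2 n) gamma delta
                           (theta_hat n w 0 j) in
     is_minimizer Theta (penalized kappa (theta_hat n w)) (theta_tilde n w))
  (* P-O estimator *)
  (theta_check : nat -> Om -> 'rV[R]_q)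
  (theta_check_rv : forall n, (0 < n)%N -> random_matrix (theta_check n))
  (theta_check_in : forall n w, (0 < n)%N -> Theta (theta_check n w) /\
     forall j, theta_tilde n w 0 j = 0 -> theta_check n w 0 j = 0)
  (theta_check_inf : forall n w, (0 < n)%N ->
     let Fn theta := empirical_contrast (realized_cov T X n w)
                       (sem_Sigma (sem_at model theta)) in
     let Theta_n := [set theta | Theta theta /\
                       forall j, theta_tilde n w 0 j = 0 -> theta 0 j = 0] in
     Fn (theta_check n w) = inf (Fn @` Theta_n))
  (* alternative hypothesis and quasi-true value *)
  (H1 : forall theta, Theta theta ->
     sem_Sigma (true_sem Lx10 Lx20 Gam0 B0 S1 S2 S3 S4)
     <> sem_Sigma (sem_at model theta))
  (theta_bar : 'rV[R]_q)
  (theta_bar_min :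
     let U theta := contrast
       (sem_Sigma (true_sem Lx10 Lx20 Gam0 B0 S1 S2 S3 S4))
       (sem_Sigma (sem_at model theta)) in
     [/\ is_minimizer Theta U theta_bar,
         (forall theta, is_minimizer Theta U theta -> theta = theta_bar) &
         hessian U theta_bar \in unitmx])
  (delta_lt : forall j, j \in active_set theta_bar -> delta < `|theta_bar 0 j|)
  (* asymptotics of the tuning parameters *)
  (lambda1_cvg : (fun n => Num.sqrt n%:R * lambda1 n) @ \oo --> (0 : R))
  (lambda2_cvg : (fun n => Num.sqrt n%:R * lambda2 n) @ \oo --> +oo) :
  let p := (p1 + p2)%N in
  let pbar := (p * p.+1)./2 in
  let T_check n w := n%:R * empirical_contrast (realized_cov T X n w)
                       (sem_Sigma (sem_at model (theta_check n w))) in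
  (fun n => P [set w |
     chi2_upper (pbar - #|active_set (theta_tilde n w)|)%N alpha
       < T_check n w]) @ \oo --> 1%E.
Proof.
move=> p pbar T_check.
pose m0 := true_sem Lx10 Lx20 Gam0 B0 S1 S2 S3 S4.
pose Sig0 := sem_Sigma m0.
pose Sig theta := sem_Sigma (sem_at model theta).
have pSig0 : posdef Sig0.
  by apply: sem_Sigma_posdef => //; exact: psd_gram.
have pSig theta : Theta theta -> posdef (Sig theta).
  move=> /model_adm[_ _ _ [? ?] [? ?]]; exact: sem_Sigma_posdef.
have [[bar_in bar_min] _ _] := theta_bar_min.
pose c := contrast Sig0 (Sig theta_bar).
have c_gt0 : 0 < c.
  by apply: contrast_gt0 => //; [exact: pSig|exact: H1].
have [K K0 KP] : exists2 K : R, 0 <= K & forall theta, Theta theta ->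
    forall i j, `|invmx (Sig theta) i j| <= K.
  apply: (compact_entry_bound (A := fun theta => invmx (Sig theta))) => // theta Tt.
  apply: mcvg_inv; first exact: posdef_unitmx (pSig _ Tt).
  by apply: mcvg_sem_at; have [] := model_adm _ Tt.
have c_half : 0 < c / 2 by rewrite divr_gt0.
(* Half of the gap [c] is spent on replacing [Sig0] by the realized covariance; the other half
   remains as the lower bound. *)
have [e e0 eP] := contrast_near pSig0 K0 c_half.
have [mX cQ] := sem_realized_cov T_gt0 W1_wiener W2_wiener W3_wiener W4_wiener W_indep
  xi_sde del_sde eps_sde zeta_sde B1_reg B2_reg B3_reg B4_reg Psi0_unit eta_eq X_eq.
have mQ n := @random_matrix_realized_cov _ _ _ _ _ _ n (ltW T_gt0) mX.
(* One scalar that dominates all entrywise errors, so a single deviation event has to be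
   controlled. *)
pose Z n w : R := \sum_a \sum_b `|realized_cov T X n w a b - Sig0 a b|.
have mD a b n : measurable_fun setT (fun w => `|realized_cov T X n w a b - Sig0 a b|).
  by apply: measurableT_comp => //; apply: measurable_funB => //; exact: mQ.
have mZ n : measurable_fun setT (Z n).
  by apply: measurable_sum => a; apply: measurable_sum => b; exact: mD.
have cZ : cvg_prob P Z 0.
  rewrite (_ : 0 = \sum_(a < p) \sum_(b < p) 0); last by rewrite big1// => a _; rewrite big1.
  apply: cvg_prob_sum => [a n|a]; first by apply: measurable_sum => b; exact: mD.
  apply: cvg_prob_sum => [b n|b]; first exact: mD.
  exact: cvg_prob_norm (cQ a b).
(* The truncated subtraction keeps the degrees of freedom between 0 and [pbar], so a sum over these
   values, 0 included, bounds every threshold without any monotonicity in [r]. *)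
pose M : R := \sum_(r < pbar.+1) `|chi2_upper r alpha|.
have chi_le r : (r <= pbar)%N -> chi2_upper r alpha <= M.
  move=> rp; apply: le_trans (ler_norm _) _.
  by rewrite /M (bigD1 (Ordinal (rp : (r < pbar.+1)%N)))//= lerDl sumr_ge0.
apply: (cvg_prob_event e0 mZ cZ).
near=> n.
have n0 : (0 < n)%N by near: n; exact: nbhs_infty_gt.
have nM : M < n%:R * (c / 2).
  rewrite -ltr_pdivrMr//; near: n; exact: nbhs_infty_gtr.
split.
  have mchi : measurable_fun setT (fun w =>
      chi2_upper (pbar - #|active_set (theta_tilde n w)|)%N alpha).
    apply: (@measurable_active_set _ _ _ _ (theta_tilde n)
      (fun A => chi2_upper (pbar - #|A|)%N alpha)).
    exact: theta_tilde_rv.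
  have mT : measurable_fun setT (T_check n).
    apply: measurable_funM => //; apply: measurable_empirical_contrast; first exact: mQ.
    apply: random_matrix_sem_Sigma; exact: theta_check_rv.
  have := measurable_fun_ltr mchi mT measurableT (Y := [set true]) I.
  by rewrite setTI; congr measurable.
move=> w Zw /=; apply: le_lt_trans (chi_le _ (leq_subr _ _)) _.
apply: lt_le_trans nM _; rewrite /T_check ler_wpM2l//.
have [check_in _] := theta_check_in n w n0.
have close i j : `|realized_cov T X n w i j - Sig0 i j| < e.
  apply: le_lt_trans Zw; rewrite subr0 [`|Z n w|]ger0_norm; last first.
    by apply: sumr_ge0 => a _; exact: sumr_ge0.
  rewrite /Z (bigD1 i)//= (bigD1 j)//= -addrA lerDl addr_ge0// ?sumr_ge0//.
  by move=> a _; exact: sumr_ge0.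
have [uQ lowQ] := eP _ close.
rewrite /empirical_contrast uQ.
apply: le_trans (lowQ _ (KP _ check_in)).
(* By minimality of [theta_bar], the contrast between [Sig0] and the model at [theta_check] is at
   least [c], of which $c/2$ survives. *)
have := bar_min _ check_in; rewrite -/c -/Sig0 -/(Sig _); lra.
Unshelve. all: by end_near. Qed.
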